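(* Let $B=B(G,\underline g,\underline\chi)$ be a quantum linear space bosonization (QLS) of rank $\theta$ over $\Bbbk$ and let $R$ be a left $B$-module algebra that is a domain. The following are equivalent: (1) $R\#B$ is prime. (2) $t_\chi(R)\neq 0$ for all $\chi\in\widehat G$. (3) After possibly reordering the indices $1,\dots,\theta$ (that is, for some simultaneous permutation of the triples $(g_i,\chi_i,x_i)$), $x_{k+1}(R_k)\neq 0$ for all $k\in\{0,\dots,\theta-1\}$, and for each $\chi\in\widehat G$ there exists a nonzero $a\in R^x$ such that $g(a)=\chi(g^{-1})a$ for all $g\in G$.
   Context: $\Bbbk$ is an algebraically closed field of characteristic zero; all algebras are associative unital $\Bbbk$-algebras (a domain need not be commutative) and tensor products are over $\Bbbk$. For a group $G$, $\widehat G=\mathrm{Hom}(G,\Bbbk^\times)$. QLS: let $\theta$ be a positive integer, $G$ a finite abelian group, $\underline g=g_1,\dots,g_\theta\in G$ (repetitions allowed, not necessarily generating $G$), $\underline\chi=\chi_1,\dots,\chi_\theta\in\widehat G$, with $m_i=\mathrm{ord}(\chi_i(g_i))\ge 2$ (order in $\Bbbk^\times$) and $\chi_i(g_j)\chi_j(g_i)=1$ for $i\ne j$. The bosonization of a quantum linear space over $G$ (QLS), of rank $\theta$, is the Hopf algebra $B(G,\underline g,\underline\chi)$ generated over $\Bbbk$ by the grouplikes $G$ and $(g_i,1)$-skew-primitive elements $x_1,\dots,x_\theta$ (so $\Delta(x_i)=g_i\otimes x_i+x_i\otimes 1$) with relations (besides those of $G$) $gx_i=\chi_i(g)x_ig$,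 $x_i^{m_i}=0$, $x_ix_j=\chi_j(g_i)x_jx_i$ for all $g\in G$ and all $i\neq j$. A left $H$-module algebra $R$ over a Hopf algebra $H$ is an algebra that is a left $H$-module with $h\cdot 1_R=\varepsilon(h)1_R$ and $h\cdot(rr')=\sum(h_1\cdot r)(h_2\cdot r')$. The smash product $R\#H$ is $R\otimes H$ as a vector space with multiplication $(r\#h)(r'\#h')=\sum r(h_1\cdot r')\#h_2h'$. We write $h(r)$ for $h\cdot r$. $R^{\langle x_i\rangle}=\{r\in R: x_i(r)=0\}$; $R_0=R$, $R_k=\bigcap_{i=1}^kR^{\langle x_i\rangle}$ for $1\le k\le\theta$, and $R^x=R_\theta$. For $\chi\in\widehat G$ put $e_\chi=\frac1{|G|}\sum_{g\in G}\chi(g)g\in B$, $\mathbf x=x_1^{m_1-1}x_2^{m_2-1}\cdots x_\theta^{m_\theta-1}\in B$, and $t_\chi=e_\chi\mathbf x\in B$; $t_\chi(R)=\{t_\chi\cdot r: r\in R\}$. *)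

(* Defs.v *)
From HB Require Import structures.
From mathcomp Require Import all_fingroup all_boot all_algebra.
From mathcomp Require Import boolp.

Set Implicit Arguments.
Unset Strict Implicit.
Unset Printing Implicit Defensive.

Import GRing.Theory.
Local Open Scope ring_scope.
Local Open Scope quotient_scope.

Local Notation bilinear f := (bilinear_for *:%R *:%R f).

Section TensorProduct.
Context {k : fieldType}.

Section Construction.
Variables V W : lmodType k.
Implicit Types s t : seq (V * W).

(* A sequence of pairs is read as a formal sum of pure tensors; two formal
   sums are the same tensor when no bilinear map out of V * W separates them. *)
Definition teval (U : lmodType k) (f : V -> W -> U) s : U :=
  \sum_(p <- s) f p.1 p.2.

Definition teq s t : bool :=
  `[< forall (U : lmodType k) (f : V -> W -> U),
        bilinear f -> teval f s = teval f t >].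

Lemma teqP s t : reflect (forall (U : lmodType k) (f : V -> W -> U),
  bilinear f -> teval f s = teval f t) (teq s t).
Proof. exact: asboolP. Qed.

Lemma teq_refl : reflexive teq. Proof. by move=> s; apply/teqP. Qed.
Lemma teq_sym : symmetric teq.
Proof. by move=> s t; apply/teqP/teqP => H U f bf; rewrite H. Qed.
Lemma teq_trans : transitive teq.
Proof.
by move=> s t u /teqP H1 /teqP H2; apply/teqP => U f bf; rewrite H1 ?H2.
Qed.

Canonical teq_equiv := EquivRel teq teq_refl teq_sym teq_trans.

Definition tens := {eq_quot teq}.
HB.instance Definition _ := Choice.on tens.
HB.instance Definition _ := EqQuotient.on tens.

Definition tclass s : tens := \pi_tens s.
Definition pure (v : V) (w : W) : tens := tclass [:: (v, w)].

(* The value at a tensor of the linear map induced by [f]; it depends on the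
   choice of a representative unless [f] is bilinear. *)
Definition tlift (U : nmodType) (f : V -> W -> U) (z : tens) : U :=
  \sum_(p <- repr z) f p.1 p.2.

Lemma tclassP s t : tclass s = tclass t <->
  forall (U : lmodType k) (f : V -> W -> U),
    bilinear f -> teval f s = teval f t.
Proof.
split=> [/eqmodP /= /teqP //|H]; apply/eqmodP => /=; exact/teqP.
Qed.

Lemma tlift_class (U : lmodType k) (f : V -> W -> U) s :
  bilinear f -> tlift f (tclass s) = teval f s.
Proof. by move=> bf; apply: (tclassP _ _).1 bf; rewrite /tclass reprK. Qed.

Lemma tclass_repr (z : tens) : tclass (repr z) = z.
Proof. by rewrite /tclass reprK. Qed.

Definition tadd (y z : tens) := tclass (repr y ++ repr z).
Definition tscale (c : k) (z : tens) :=
  tclass [seq (c *: p.1, p.2) | p <- repr z].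
Definition topp := tscale (-1).
Definition tzero := tclass [::].

Lemma teval_cat (U : lmodType k) (f : V -> W -> U) s t :
  teval f (s ++ t) = teval f s + teval f t.
Proof. by rewrite /teval big_cat. Qed.

Lemma bilDl (U : lmodType k) (f : V -> W -> U) : bilinear f ->
  forall v v' w, f (v + v') w = f v w + f v' w.
Proof. by move=> bf v v' w; have := bf.1 w 1 v v'; rewrite /= !scale1r. Qed.

Lemma bilDr (U : lmodType k) (f : V -> W -> U) : bilinear f ->
  forall v w w', f v (w + w') = f v w + f v w'.
Proof. by move=> bf v w w'; have := bf.2 v 1 w w'; rewrite /= !scale1r. Qed.

Lemma bilZl (U : lmodType k) (f : V -> W -> U) : bilinear f ->
  forall c v w, f (c *: v) w = c *: f v w.
Proof.
move=> bf c v w; have := bf.1 w c v 0; rewrite addr0 /= => ->.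
have /eqP := bilDl bf 0 0 w; rewrite addr0 -subr_eq subrr => /eqP <-.
by rewrite addr0.
Qed.

Lemma bilZr (U : lmodType k) (f : V -> W -> U) : bilinear f ->
  forall c v w, f v (c *: w) = c *: f v w.
Proof.
move=> bf c v w; have := bf.2 v c w 0; rewrite addr0 /= => ->.
have /eqP := bilDr bf v 0 0; rewrite addr0 -subr_eq subrr => /eqP <-.
by rewrite addr0.
Qed.

Lemma teval_scale (U : lmodType k) (f : V -> W -> U) c s : bilinear f ->
  teval f [seq (c *: p.1, p.2) | p <- s] = c *: teval f s.
Proof.
move=> bf; rewrite /teval big_map scaler_sumr.
by apply: eq_bigr => p _ /=; rewrite bilZl.
Qed.

Lemma tens_eqP (y z : tens) : y = z <->
  forall (U : lmodType k) (f : V -> W -> U), bilinear f ->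
    tlift f y = tlift f z.
Proof.
split=> [-> //|H]; rewrite -(tclass_repr y) -(tclass_repr z).
by apply/tclassP => U f bf; exact: H.
Qed.

Lemma tlift_add (U : lmodType k) (f : V -> W -> U) : bilinear f ->
  forall y z, tlift f (tadd y z) = tlift f y + tlift f z.
Proof. by move=> bf y z; rewrite tlift_class // teval_cat. Qed.

Lemma tlift_scale (U : lmodType k) (f : V -> W -> U) : bilinear f ->
  forall c z, tlift f (tscale c z) = c *: tlift f z.
Proof. by move=> bf c z; rewrite tlift_class // teval_scale. Qed.

Lemma tlift_zero (U : lmodType k) (f : V -> W -> U) : bilinear f ->
  tlift f tzero = 0.
Proof. by move=> bf; rewrite tlift_class // /teval big_nil. Qed.

Lemma taddA : associative tadd.
Proof.
by move=> x y z; apply/tens_eqP => U f bf; rewrite !tlift_add // addrA.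
Qed.
Lemma taddC : commutative tadd.
Proof.
by move=> x y; apply/tens_eqP => U f bf; rewrite !tlift_add // addrC.
Qed.
Lemma tadd0 : left_id tzero tadd.
Proof.
by move=> x; apply/tens_eqP => U f bf; rewrite tlift_add // tlift_zero // add0r.
Qed.
Lemma taddN : left_inverse tzero topp tadd.
Proof.
move=> x; apply/tens_eqP => U f bf.
by rewrite tlift_add // tlift_zero // tlift_scale // scaleN1r addNr.
Qed.

HB.instance Definition _ := GRing.isZmodule.Build tens taddA taddC tadd0 taddN.

Lemma tscaleA a b z : tscale a (tscale b z) = tscale (a * b) z.
Proof. by apply/tens_eqP => U f bf; rewrite !tlift_scale // scalerA. Qed.
Lemma tscale1 : left_id 1 tscale.
Proof. by move=> z; apply/tens_eqP => U f bf; rewrite tlift_scale // scale1r. Qed.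
Lemma tscaleDr : right_distributive tscale +%R.
Proof.
move=> a y z; apply/tens_eqP => U f bf.
by rewrite tlift_scale // !tlift_add // !tlift_scale // scalerDr.
Qed.
Lemma tscaleDl z : {morph tscale^~ z : a b / a + b}.
Proof.
move=> a b; apply/tens_eqP => U f bf.
by rewrite tlift_scale // tlift_add // !tlift_scale // scalerDl.
Qed.

HB.instance Definition _ :=
  GRing.Zmodule_isLmodule.Build k tens tscaleA tscale1 tscaleDr tscaleDl.

Lemma tlift_linear (U : lmodType k) (f : V -> W -> U) :
  bilinear f -> linear (tlift f).
Proof. by move=> bf a y z; rewrite tlift_add // tlift_scale. Qed.

Lemma tlift_pure (U : lmodType k) (f : V -> W -> U) v w :
  bilinear f -> tlift f (pure v w) = f v w.
Proof. by move=> bf; rewrite tlift_class // /teval big_seq1. Qed.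

Lemma pure_bilinear : bilinear pure.
Proof.
split=> [w|v] a x y; apply/tens_eqP => U f bf.
- by rewrite tlift_linear // !tlift_pure // bilDl // bilZl.
- by rewrite tlift_linear // !tlift_pure // bilDr // bilZr.
Qed.

Lemma tens_sum (z : tens) : z = \sum_(p <- repr z) pure p.1 p.2.
Proof.
apply/tens_eqP => U f bf.
have lin0 : tlift f 0 = 0 by exact: tlift_zero.
rewrite (big_morph _ (fun y z => tlift_add bf y z) lin0).
by apply: eq_bigr => p _; rewrite tlift_pure.
Qed.

Lemma eq_tlift (U : nmodType) (f g : V -> W -> U) :
  f =2 g -> tlift f =1 tlift g.
Proof. by move=> fg z; apply: eq_bigr => p _; rewrite fg. Qed.

End Construction.
End TensorProduct.

Notation "v '⊗' w" := (pure v w) (at level 40, left associativity) : ring_scope.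

(* [\Sw_(a, b <- z) F] is the sum of the F(a, b) over an expression of the tensor
   z as a sum of the a ⊗ b; for z = comul h this is Sweedler's notation. *)
Notation "'\Sw_' ( a , b <- z ) F" := (tlift (fun a b => F) z)
  (at level 41, F at level 41, a name, b name,
   format "'\Sw_' ( a ,  b  <-  z )  F") : ring_scope.

Section HopfAlgebras.
Context {k : fieldType}.

Record hopf_algebra (H : algType k) := HopfAlgebra {
  comul : {linear H -> tens H H};
  counit : {linear H -> k^o};
  antipode : {linear H -> H};
  comul1 : comul 1 = 1 ⊗ 1;
  comulM : forall a b, comul (a * b) =
    \Sw_(a1, a2 <- comul a) \Sw_(b1, b2 <- comul b) ((a1 * b1) ⊗ (a2 * b2));
  counit1 : counit 1 = 1;
  counitM : forall a b, counit (a * b) = counit a * counit b;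
  comulA : forall h,
    \Sw_(h1, h2 <- comul h) \Sw_(a, b <- comul h1) (a ⊗ b ⊗ h2) =
    \Sw_(h1, h2 <- comul h) \Sw_(a, b <- comul h2) (h1 ⊗ a ⊗ b);
  counitl : forall h, \Sw_(h1, h2 <- comul h) (counit h1 *: h2) = h;
  counitr : forall h, \Sw_(h1, h2 <- comul h) (counit h2 *: h1) = h;
  antipodel : forall h,
    \Sw_(h1, h2 <- comul h) (antipode h1 * h2) = counit h *: 1;
  antipoder : forall h,
    \Sw_(h1, h2 <- comul h) (h1 * antipode h2) = counit h *: 1 }.

Record module_algebra (H : algType k) (Hs : hopf_algebra H) (R : algType k) :=
  ModuleAlgebra {
  act :> H -> R -> R;
  act_bilinear : bilinear act;
  act1 : forall r, act 1 r = r;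
  actM : forall a b r, act (a * b) r = act a (act b r);
  act_one : forall h, act h 1 = counit Hs h *: 1;
  act_mul : forall h r s,
    act h (r * s) = \Sw_(h1, h2 <- comul Hs h) (act h1 r * act h2 s) }.

Section Smash.
Variables (H : algType k) (Hs : hopf_algebra H) (R : algType k).

Definition smash of module_algebra Hs R : Type := tens R H.
HB.instance Definition _ M := GRing.Lmodule.on (smash M).

Variable M : module_algebra Hs R.
Local Notation RH := (smash M).

Definition smash_mul_pure (r : R) (h : H) (s : R) (l : H) : RH :=
  \Sw_(h1, h2 <- comul Hs h) ((r * M h1 s) ⊗ (h2 * l)).

Definition smash_mul (y z : RH) : RH :=
  \Sw_(r, h <- y) \Sw_(s, l <- z) smash_mul_pure r h s l.

Definition smash_one : RH := 1 ⊗ 1.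

Lemma pureDl (V W : lmodType k) (v v' : V) (w : W) :
  (v + v') ⊗ w = v ⊗ w + v' ⊗ w.
Proof. exact: bilDl (pure_bilinear V W) v v' w. Qed.
Lemma pureDr (V W : lmodType k) (v : V) (w w' : W) :
  v ⊗ (w + w') = v ⊗ w + v ⊗ w'.
Proof. exact: bilDr (pure_bilinear V W) v w w'. Qed.
Lemma pureZl (V W : lmodType k) c (v : V) (w : W) :
  (c *: v) ⊗ w = c *: (v ⊗ w).
Proof. exact: bilZl (pure_bilinear V W) c v w. Qed.
Lemma pureZr (V W : lmodType k) c (v : V) (w : W) :
  v ⊗ (c *: w) = c *: (v ⊗ w).
Proof. exact: bilZr (pure_bilinear V W) c v w. Qed.

Lemma tliftP (V W U : lmodType k) (f : V -> W -> U) c :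
  bilinear f -> forall y z, tlift f (c *: y + z) = c *: tlift f y + tlift f z.
Proof. by move=> bf y z; exact: tlift_linear. Qed.

Lemma tliftDf (V W U : lmodType k) c (f g : V -> W -> U) z :
  \Sw_(a, b <- z) (c *: f a b + g a b) = c *: tlift f z + tlift g z.
Proof. by rewrite /tlift big_split /= scaler_sumr. Qed.

Lemma actl c a b r : M (c *: a + b) r = c *: M a r + M b r.
Proof. exact: (act_bilinear M).1 r c a b. Qed.
Lemma actr c h r s : M h (c *: r + s) = c *: M h r + M h s.
Proof. exact: (act_bilinear M).2 h c r s. Qed.

Lemma smash_aux_bilin r s l :
  bilinear (fun h1 h2 : H => (r * M h1 s) ⊗ (h2 * l) : RH).
Proof.
split=> [h|h] c a b /=.
- by rewrite actl mulrDr -scalerAr pureDl pureZl.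
- by rewrite mulrDl -scalerAl pureDr pureZr.
Qed.

Lemma smash_mul_bilinl s l : bilinear (fun r h => smash_mul_pure r h s l).
Proof.
split=> [h|r] c a b; rewrite /smash_mul_pure /=.
- rewrite -tliftDf; apply: eq_tlift => h1 h2.
  by rewrite mulrDl -scalerAl pureDl pureZl.
- by rewrite linearP tliftP //; exact: smash_aux_bilin.
Qed.

Lemma smash_mul_bilinr r h : bilinear (smash_mul_pure r h).
Proof.
split=> [l|s] c a b; rewrite /smash_mul_pure /= -tliftDf;
  apply: eq_tlift => h1 h2.
- by rewrite actr mulrDr -scalerAr pureDl pureZl.
- by rewrite mulrDr -scalerAr pureDr pureZr.
Qed.

Lemma smash_mul_lift_bilin z :
  bilinear (fun r h => tlift (smash_mul_pure r h) z).
Proof.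
split=> [h|r] c a b /=; rewrite -tliftDf; apply: eq_tlift => s l.
- exact: (smash_mul_bilinl s l).1 h c a b.
- exact: (smash_mul_bilinl s l).2 r c a b.
Qed.

Lemma smash_mulP c x y z :
  smash_mul (c *: x + y) z = c *: smash_mul x z + smash_mul y z.
Proof. exact/tliftP/smash_mul_lift_bilin. Qed.

Lemma smash_mulPr c x y z :
  smash_mul x (c *: y + z) = c *: smash_mul x y + smash_mul x z.
Proof.
rewrite /smash_mul -tliftDf; apply: eq_tlift => r h.
exact/tliftP/smash_mul_bilinr.
Qed.

Lemma smash_mulDl : left_distributive smash_mul +%R.
Proof. by move=> x y z; have := smash_mulP 1 x y z; rewrite !scale1r. Qed.
Lemma smash_mulDr : right_distributive smash_mul +%R.
Proof. by move=> x y z; have := smash_mulPr 1 x y z; rewrite !scale1r. Qed.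
Lemma smash_mul0 z : smash_mul 0 z = 0.
Proof.
by apply: (addrI (smash_mul 0 z)); rewrite -smash_mulDl !addr0.
Qed.
Lemma smash_mulr0 z : smash_mul z 0 = 0.
Proof.
by apply: (addrI (smash_mul z 0)); rewrite -smash_mulDr !addr0.
Qed.
Lemma smash_suml I (s : seq I) (F : I -> RH) z :
  smash_mul (\sum_(i <- s) F i) z = \sum_(i <- s) smash_mul (F i) z.
Proof.
exact: (big_morph (smash_mul^~ z) (fun x y => smash_mulDl x y z) (smash_mul0 z)).
Qed.
Lemma smash_sumr I (s : seq I) (F : I -> RH) z :
  smash_mul z (\sum_(i <- s) F i) = \sum_(i <- s) smash_mul z (F i).
Proof.
exact: (big_morph (smash_mul z) (smash_mulDr z) (smash_mulr0 z)).
Qed.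

Lemma smash_mulE r h s l :
  smash_mul (r ⊗ h) (s ⊗ l) =
  \Sw_(h1, h2 <- comul Hs h) ((r * M h1 s) ⊗ (h2 * l)).
Proof.
rewrite /smash_mul tlift_pure; last exact: smash_mul_lift_bilin.
by rewrite tlift_pure //; exact: smash_mul_bilinr.
Qed.

Lemma tens_ind (V W : lmodType k) (P : tens V W -> Prop) :
  P 0 -> (forall y z, P y -> P z -> P (y + z)) ->
  (forall v w, P (v ⊗ w)) -> forall z, P z.
Proof. by move=> P0 PD Pp z; rewrite (tens_sum z); elim/big_ind: _. Qed.

Lemma smash_mul1l : left_id smash_one smash_mul.
Proof.
elim/tens_ind => [|y z IHy IHz|r h]; first exact: smash_mulr0.
  by rewrite smash_mulDr IHy IHz.
rewrite smash_mulE comul1 tlift_pure; last exact: smash_aux_bilin.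
by rewrite act1 !mul1r.
Qed.

Lemma smash_mul1r : right_id smash_one smash_mul.
Proof.
elim/tens_ind => [|y z IHy IHz|r h]; first exact: smash_mul0.
  by rewrite smash_mulDl IHy IHz.
rewrite smash_mulE -[in RHS](counitl Hs h).
rewrite /tlift (big_morph (pure r) (pureDr r) (id1 := 0)); last first.
  by rewrite -[0 in LHS](scale0r (0 : H)) pureZr scale0r.
apply: eq_bigr => p _; rewrite act_one -scalerAr !mulr1.
by rewrite pureZl pureZr.
Qed.

Lemma tlift_sum (V W U : lmodType k) (f : V -> W -> U) I (s : seq I) F :
  bilinear f -> tlift f (\sum_(i <- s) F i) = \sum_(i <- s) tlift f (F i).
Proof.
move=> bf; apply: big_morph => [y z|]; first exact: tlift_add.
exact: tlift_zero.
Qed.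

Lemma tlift_comp (V W V' W' U : lmodType k) (f : V -> W -> U)
    (F : V' -> W' -> tens V W) z : bilinear f ->
  tlift f (tlift F z) = \Sw_(a, b <- z) tlift f (F a b).
Proof. by move=> bf; rewrite {2}/tlift tlift_sum. Qed.

Lemma smash_mulA : associative smash_mul.
Proof.
move=> x y z; elim/tens_ind: x => [|x x' IHx IHx'|r h].
- by rewrite !smash_mul0.
- by rewrite !smash_mulDl IHx IHx'.
elim/tens_ind: y => [|y y' IHy IHy'|s l].
- by rewrite smash_mul0 !smash_mulr0 smash_mul0.
- by rewrite smash_mulDl !smash_mulDr smash_mulDl IHy IHy'.
elim/tens_ind: z => [|z z' IHz IHz'|t m].
- by rewrite !smash_mulr0.
- by rewrite !smash_mulDr IHz IHz'.
pose T (l1 l2 a b c : H) : RH :=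
  (r * (M a s * M b (M l1 t))) ⊗ (c * (l2 * m)).
have Tbil l1 l2 c : bilinear (fun a b => T l1 l2 a b c).
  split=> [b|a] e u v; rewrite /T /=.
  - by rewrite actl mulrDl mulrDr -scalerAl -scalerAr pureDl pureZl.
  - by rewrite actl !mulrDr -!scalerAr pureDl pureZl.
have Tbil2 l1 l2 : bilinear (fun z c => \Sw_(a, b <- z) T l1 l2 a b c).
  split=> [c|w] e u v /=; first exact/tliftP/Tbil.
  rewrite -tliftDf; apply: eq_tlift => a b; rewrite /T.
  by rewrite mulrDl -scalerAl pureDr pureZr.
have coassT l1 l2 :
    \Sw_(h1, h2 <- comul Hs h) \Sw_(a, b <- comul Hs h1) T l1 l2 a b h2 =
    \Sw_(h1, h2 <- comul Hs h) \Sw_(a, b <- comul Hs h2) T l1 l2 h1 a b.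
  set P := fun z c => \Sw_(a, b <- z) T l1 l2 a b c.
  have PE a b c : tlift P (a ⊗ b ⊗ c) = T l1 l2 a b c.
    by rewrite (tlift_pure _ _ (Tbil2 l1 l2)) (tlift_pure _ _ (Tbil l1 l2 c)).
  have PsumE (F : H -> H -> tens (tens H H) H) z :
      tlift P (tlift F z) = \Sw_(a, b <- z) tlift P (F a b).
    exact: tlift_comp (Tbil2 l1 l2).
  have := congr1 (tlift P) (comulA Hs h); rewrite !PsumE.
  rewrite (eq_tlift (g := fun h1 h2 =>
    \Sw_(a, b <- comul Hs h1) T l1 l2 a b h2)); last first.
    by move=> h1 h2; rewrite PsumE; apply: eq_tlift => a b; exact: PE.
  move=> ->; apply: eq_tlift => h1 h2; rewrite PsumE.
  by apply: eq_tlift => a b; exact: PE.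
transitivity (\Sw_(l1, l2 <- comul Hs l) \Sw_(h1, h2 <- comul Hs h)
                \Sw_(a, b <- comul Hs h1) T l1 l2 a b h2).
  rewrite smash_mulE {1}/tlift smash_sumr; apply: eq_bigr => p _.
  rewrite smash_mulE; apply: eq_tlift => h1 h2.
  rewrite act_mul {1}/tlift mulr_sumr.
  rewrite (big_morph (fun u => u ⊗ _) (fun u v => pureDl u v _) (id1 := 0)) //.
  by rewrite -[0 in LHS](scale0r (0 : R)) pureZl scale0r.
transitivity (\Sw_(l1, l2 <- comul Hs l) \Sw_(h1, h2 <- comul Hs h)
                \Sw_(a, b <- comul Hs h2) T l1 l2 h1 a b).
  by apply: eq_tlift => l1 l2; exact: coassT.
rewrite smash_mulE {2}/tlift smash_suml {1 2}/tlift exchange_big /=.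
apply: eq_bigr => p _; rewrite smash_mulE comulM.
set F := fun h1 h2 : H => _.
have bF : bilinear F by exact: smash_aux_bilin.
rewrite (tlift_comp _ _ bF).
under [RHS]eq_tlift => a b do rewrite (tlift_comp _ _ bF).
rewrite exchange_big /=; apply: eq_bigr => q _; apply: eq_bigr => w _.
by rewrite (tlift_pure _ _ bF) /F /T actM !mulrA.
Qed.

HB.instance Definition _ := GRing.Zmodule_isPzRing.Build RH
  smash_mulA smash_mul1l smash_mul1r smash_mulDl smash_mulDr.

End Smash.

End HopfAlgebras.

Definition prime_ring (A : pzRingType) : Prop :=
  (1 : A) <> 0 /\
  forall a b : A, (forall c : A, a * c * b = 0) -> a = 0 \/ b = 0.

Section QuantumLinearSpaces.
Variables (k : closedFieldType) (gT : finGroupType).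

(* The values are automatically units, so this is Hom(G, k^* ). *)
Definition group_char (chi : gT -> k) : Prop :=
  chi 1%g = 1 /\ {morph chi : g h / (g * h)%g >-> g * h}.

Record qls_datum (theta : nat) := QlsDatum {
  qg : 'I_theta -> gT;
  qchi : 'I_theta -> gT -> k;
  qm : 'I_theta -> nat;
  qrank_gt0 : (0 < theta)%N;
  qabelian : abelian [set: gT];
  qchi_char : forall i, group_char (qchi i);
  qm_order : forall i, (qm i).-primitive_root (qchi i (qg i));
  qm_ge2 : forall i, (2 <= qm i)%N;
  qchi_braid : forall i j, i != j -> qchi i (qg j) * qchi j (qg i) = 1 }.

Section Bosonization.
Variables (theta : nat) (D : qls_datum theta).

Definition qls_relations (A : algType k) (u : gT -> A) (y : 'I_theta -> A)
    : Prop :=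
  [/\ u 1%g = 1 /\ {morph u : g h / (g * h)%g >-> g * h},
      forall g i, u g * y i = qchi D i g *: (y i * u g),
      forall i, y i ^+ qm D i = 0 &
      forall i j, i != j -> y i * y j = qchi D j (qg D i) *: (y j * y i)].

(* A is the algebra presented by the generators u g, y i and the relations
   above: it is universal among the algebras with such elements. *)
Definition qls_presented (A : algType k) (u : gT -> A) (y : 'I_theta -> A)
    : Prop :=
  qls_relations u y /\
  forall (A' : algType k) (u' : gT -> A') (y' : 'I_theta -> A'),
    qls_relations u' y' ->
    exists f : {lrmorphism A -> A'},
      ((forall g, f (u g) = u' g) /\ (forall i, f (y i) = y' i)) /\
      forall f' : {lrmorphism A -> A'},
        (forall g, f' (u g) = u' g) -> (forall i, f' (y i) = y' i) -> f' =1 f.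

(* [B], with its Hopf structure [Hs], is B(G, g, chi); [iota] is the map from
   G to B. *)
Record qls_bosonization (B : algType k) (Hs : hopf_algebra B)
    (iota : gT -> B) (x : 'I_theta -> B) : Prop := QlsBosonization {
  bos_presented : qls_presented iota x;
  bos_comul_g : forall g, comul Hs (iota g) = iota g ⊗ iota g;
  bos_counit_g : forall g, counit Hs (iota g) = 1;
  bos_comul_x : forall i,
    comul Hs (x i) = iota (qg D i) ⊗ x i + x i ⊗ 1 }.

Definition char_idem (B : algType k) (iota : gT -> B) (chi : gT -> k) : B :=
  #|gT|%:R^-1 *: \sum_g chi g *: iota g.

Definition top_monomial (B : algType k) (x : 'I_theta -> B) : B :=
  \prod_(i < theta) x i ^+ (qm D i).-1.

Definition t_elt (B : algType k) (iota : gT -> B) (x : 'I_theta -> B)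
    (chi : gT -> k) : B :=
  char_idem iota chi * top_monomial x.

End Bosonization.

(* r lies in R_n, the common kernel of the first n of the x i (indices start
   at 0); for n = theta this is R^x. *)
Definition killed_by (theta : nat) (B R : algType k) (Hs : hopf_algebra B)
    (M : module_algebra Hs R) (x : 'I_theta -> B) (n : nat) (r : R) : Prop :=
  forall i : 'I_theta, (i < n)%N -> M (x i) r = 0.

End QuantumLinearSpaces.

(* Main.v *)
(* Grouplikes act on R by automorphisms and x_i acts as a g_i-skew derivation,
   so R^x is a G-stable subalgebra, and every nonzero element of a subspace
   stable under the x_i can be pushed into R^x by applying powers of the x_i.

   (1) => (2): B t_chi is a line, and in R # B one has
   t_chi r t_1 = t_chi(r) t_1; so t_chi(R) = 0 makes t_chi (R # B) t_1 vanish.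
   (2) => (3): t_chi(r) lies in R^x and has weight chi^-1, while
   x^(top - e_i)(r) is killed by every x_j with j <> i but not by x_i.
   (3) => (2): choose r_i in R_i with x_i(r_i) a nonzero element of R^x. By the
   q-Leibniz rule x_i^n(r_i^n) is again a nonzero element of R^x for n < m_i, so
   the top monomial does not vanish on the product of the r_i^(m_i - 1);
   multiplying by a weight vector of R^x then reaches every t_chi.
   (2) => (1): right multiplication by B turns any nonzero element of R # B into
   some p # t_chi with p <> 0. If a (R # B) (v # t_chi') = 0, then v may be
   replaced by a weight vector s of R^x, say of weight mu, and
   t_chi(r s) = t_(chi mu)(r) s does not vanish for some r. *)

Require Import Defs.
From HB Require Import structures.
From mathcomp Require Import all_fingroup all_boot all_algebra.
From mathcomp Require Import boolp.

Set Implicit Arguments.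
Unset Strict Implicit.
Unset Printing Implicit Defensive.

Import GRing.Theory.
Local Open Scope ring_scope.

Local Notation bilinear f := (bilinear_for *:%R *:%R f).

(** The operators are applied from the right end of [l]. The last nonzero partial composite still
    satisfies [Q], and the next operator kills it. *)
Lemma last_nonzero (I : eqType) (V : nmodType) (F : I -> V -> V) (Q : V -> Prop)
    (l : seq I) (v : V) :
  (forall i w, Q w -> Q (F i w)) -> Q v -> v <> 0 -> foldr F v l = 0 ->
  exists i w, [/\ i \in l, Q w, w <> 0 & F i w = 0].
Proof.
move=> QF Qv nv; elim: l => [|i l IHl] //= Fv0.
have [w0|nw] := EM (foldr F v l = 0).
  by have [j [w [jl Qw nw e]]] := IHl w0; exists j, w; rewrite inE jl orbT.
exists i, (foldr F v l); split=> //; first by rewrite inE eqxx.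
by elim: (l) => //= j l' IHl'; apply: QF.
Qed.

Lemma last_iter (V : nmodType) (f : V -> V) (Q : V -> Prop) (n : nat) (v : V) :
  (forall w, Q w -> Q (f w)) -> Q v -> v <> 0 -> iter n f v = 0 ->
  exists w, [/\ Q w, w <> 0 & f w = 0].
Proof.
move=> Qf Qv nv fv.
have [|_ [w [_ Qw nw fw]]] :=
    @last_nonzero _ _ (fun _ : nat => f) Q (iota 0 n) v (fun _ => Qf) Qv nv.
  by rewrite -{}fv; elim: n 0%N => //= n IHn m; rewrite IHn.
by exists w.
Qed.

(** * Weight vectors and characters *)

Section Eigenvectors.
Variables (k : closedFieldType) (V : lmodType k).

(** Over an algebraically closed field [X^n - 1] is a product of factors [X - z], so the composite
    of the maps [f - z] kills [v]. The last nonzero partial composite is an eigenvector, and it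
    still satisfies [Q]. *)
Lemma eigenvector_finite_order (f : V -> V) (n : nat) (Q : V -> Prop) (v : V) :
  linear f -> (0 < n)%N -> iter n f v = v ->
  (forall a w, Q w -> Q (f w - a *: w)) -> Q v -> v <> 0 ->
  exists a w, [/\ Q w, w <> 0 & f w = a *: w].
Proof.
move=> lf; case: n => // n n0 fn QF Qv nv.
have fD x y : f (x + y) = f x + f y by rewrite -[x in LHS]scale1r lf scale1r.
have f0 : f 0 = 0 by apply: (addrI (f 0)); rewrite -fD !addr0.
have fZ a x : f (a *: x) = a *: f x.
  by rewrite -[_ *: _ in LHS]addr0 lf f0 addr0.
have fS I (r : seq I) F : f (\sum_(i <- r) F i) = \sum_(i <- r) f (F i).
  exact: big_morph.
(* [ev N p] is [p(f)(v)] computed from the first [N] coefficients of [p]; any [N >= size p] gives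
   the same value ([evE]), and multiplying [p] by [X - a] amounts to applying [f - a] ([evM]). *)
pose ev N (p : {poly k}) := \sum_(i < N) p`_i *: iter i f v.
have evE N (p : {poly k}) : (size p <= N)%N -> ev N.+1 p = ev N p.
  by move=> h; rewrite /ev big_ord_recr /= nth_default // scale0r addr0.
have evM a (p : {poly k}) N : (size p <= N)%N ->
    ev N.+1 (('X - a%:P) * p) = f (ev N p) - a *: ev N p.
  move=> h; have -> : a *: ev N p = a *: ev N.+1 p by rewrite evE.
  have fev : f (ev N p) = \sum_(i < N.+1) ('X * p)`_i *: iter i f v.
    rewrite /ev fS [RHS]big_ord_recl coefXM eqxx scale0r add0r.
    by apply: eq_bigr => i _; rewrite fZ coefXM /=.
  rewrite fev /ev scaler_sumr.
  rewrite -sumrB; apply: eq_bigr => i _.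
  by rewrite mulrBl coefB coefCM scalerA -scalerBl.
have [rs rsE] := closed_field_poly_normal ('X^(n.+1) - 1%:P : {poly k}).
rewrite lead_coefXnsubC // scale1r in rsE.
have rsz : size rs = n.+1.
  apply: succn_inj; rewrite -(size_XnsubC (1 : k) n0) rsE.
  by rewrite size_prod_XsubC.
have key l : ev (size l).+1 (\prod_(z <- l) ('X - z%:P)) =
    foldr (fun a w => f w - a *: w) v l.
  elim: l => [|a l IHl] /=.
    by rewrite big_nil /ev big_ord1 coefC eqxx scale1r.
  by rewrite big_cons evM ?IHl // size_prod_XsubC.
have [|a [w [_ Qw nw fw]]] :=
    @last_nonzero _ _ (fun a w => f w - a *: w) Q rs v QF Qv nv.
  rewrite -key -rsE rsz /ev big_ord_recr big_ord_recl /=.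
  rewrite big1 => [|i _]; last first.
    rewrite coefB coefXn coefC /bump /= add1n eqSS (ltn_eqF (ltn_ord i)).
    by rewrite subr0 scale0r.
  rewrite !coefB !coefXn !coefC !eqxx /= subr0 sub0r -iterS fn.
  by rewrite addr0 scaleN1r scale1r addNr.
by exists a, w; split=> //; apply/eqP; rewrite -subr_eq0 fw.
Qed.

End Eigenvectors.

Section Characters.
Variables (k : closedFieldType) (gT : finGroupType).
Implicit Types chi psi : gT -> k.

Lemma group_char_neq0 chi g : group_char chi -> chi g != 0.
Proof.
move=> [c1 cM]; apply: contraNneq (oner_neq0 k) => cg0.
by rewrite -c1 -(mulgV g) cM cg0 mul0r.
Qed.

Lemma group_charV chi g : group_char chi -> chi g^-1%g = (chi g)^-1.
Proof.
move=> Cchi; apply: (mulfI (group_char_neq0 g Cchi)).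
by rewrite mulfV ?group_char_neq0 // -Cchi.2 mulgV Cchi.1.
Qed.

Lemma group_char_inv chi : group_char chi -> group_char (fun g => (chi g)^-1).
Proof. by case=> c1 cM; split=> [|g h]; rewrite ?c1 ?invr1 // cM invfM. Qed.

Lemma group_char_mul chi psi :
  group_char chi -> group_char psi -> group_char (fun g => chi g * psi g).
Proof.
move=> [c1 cM] [p1 pM]; split=> [|g h]; first by rewrite c1 p1 mulr1.
by rewrite cM pM mulrACA.
Qed.

Lemma group_char1 : group_char (fun _ : gT => 1 : k).
Proof. by split=> // g h; rewrite mulr1. Qed.

Lemma group_char_exp chi n : group_char chi -> group_char (fun g => chi g ^+ n).
Proof.
by case=> c1 cM; split=> [|g h]; rewrite ?c1 ?expr1n // cM exprMn.
Qed.

Lemma group_char_prod (I : Type) (r : seq I) (F : I -> gT -> k) :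
  (forall i, group_char (F i)) -> group_char (fun g => \prod_(i <- r) F i g).
Proof.
move=> CF; split=> [|g h]; first by rewrite big1 // => i _; case: (CF i).
by rewrite -big_split; apply: eq_bigr => i _; rewrite (CF i).2.
Qed.

Variables (V : lmodType k) (rho : gT -> V -> V).
Hypotheses (rho_lin : forall g, linear (rho g)) (rho1 : forall v, rho 1%g v = v).
Hypothesis rhoM : forall g h v, rho (g * h)%g v = rho g (rho h v).
Hypothesis abelG : abelian [set: gT].

Lemma rhoC g h v : rho g (rho h v) = rho h (rho g v).
Proof. by rewrite -!rhoM (centsP abelG) ?inE. Qed.

(** The operators [rho g] commute and have finite order, so a common eigenvector is found by running
    through [G]. As this vector is nonzero, its eigenvalues are determined, and multiplicativity of
    [rho] makes them a character. *)
Lemma weight_vector (Q : V -> Prop) (v : V) :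
  (forall a g w, Q w -> Q (rho g w - a *: w)) -> Q v -> v <> 0 ->
  exists chi w,
    [/\ group_char chi, Q w, w <> 0 & forall g, rho g w = chi g *: w].
Proof.
move=> Qrho Qv nv.
have rhoZ g a x : rho g (a *: x) = a *: rho g x.
  have /eqP := rho_lin g 1 0 0; rewrite !scale1r addr0 -subr_eq subrr => /eqP e.
  by have := rho_lin g a x 0; rewrite -e !addr0.
have rhoB g a x y : rho g (x - a *: y) = rho g x - a *: rho g y.
  by rewrite [in LHS]addrC -(scaleNr a y) rho_lin scaleNr addrC.
have [w [Qw nw wE]] : exists w, [/\ Q w, w <> 0 &
    forall g, g \in enum gT -> exists a, rho g w = a *: w].
  elim: (enum gT) => [|g s [w [Qw nw ws]]]; first by exists v.
  have rhoI i x : iter i (rho g) x = rho (g ^+ i)%g x.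
    by elim: i => [|i IHi]; rewrite /= ?expg0 ?rho1 // IHi expgS rhoM.
  (* The predicate carried along also records being an eigenvector for the elements already treated;
     commutation preserves this. *)
  have [||a [u [[Qu us] nu ug]]] := @eigenvector_finite_order _ _ (rho g) #[g]%g
      (fun u => Q u /\ forall h, h \in s -> exists a, rho h u = a *: u) w
      (rho_lin g) (fingroup.order_gt0 g) _ _ (conj Qw ws) nw.
  - by rewrite rhoI expg_order rho1.
  - move=> a u [Qu us]; split=> [|h /us [b ub]]; first exact: Qrho.
    by exists b; rewrite rhoB rhoC ub rhoZ scalerBr !scalerA mulrC.
  exists u; split=> // h; rewrite inE => /orP [/eqP ->|/us //].
  by exists a.
have {wE} /choice [chi wE] g : exists a, rho g w = a *: w.
  by apply: wE; rewrite mem_enum.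
have inj a b : a *: w = b *: w -> a = b.
  move/eqP; rewrite -subr_eq0 -scalerBl scaler_eq0 subr_eq0.
  by case/orP=> /eqP // /nw.
exists chi, w; split=> //; split=> [|g h]; apply: inj.
- by rewrite -wE rho1 scale1r.
- by rewrite -wE rhoM wE rhoZ wE scalerA mulrC.
Qed.

End Characters.

Lemma card_group_neq0 (k : fieldType) (gT : finGroupType) :
  [pchar k] =i pred0 -> #|gT|%:R != 0 :> k.
Proof. by move/pcharf0P=> ->; rewrite -cardsT -lt0n cardG_gt0. Qed.

(* Translations act on the functions gT -> V; a weight vector of this action
   is a character up to a constant, and the Fourier coefficient at its inverse
   does not vanish. *)
Lemma fourier_coef_neq0 (k : closedFieldType) (gT : finGroupType)
    (V : lmodType k) (f : gT -> V) (g0 : gT) :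
  [pchar k] =i pred0 -> abelian [set: gT] -> f g0 <> 0 ->
  exists2 chi : gT -> k, group_char chi & \sum_g chi g *: f g <> 0.
Proof.
move=> ch0 abelG nf; apply: contrapT => none.
pose rho (h : gT) (f : {ffun gT -> V}) := [ffun g => f (g * h)%g].
pose Q (f : {ffun gT -> V}) :=
  forall chi : gT -> k, group_char chi -> \sum_g chi g *: f g = 0.
have [||||||chi [w [Cchi Qw nw ww]]] := @weight_vector k gT {ffun gT -> V} rho
    _ _ _ abelG Q [ffun g => f g].
- by move=> h a x y; apply/ffunP => g; rewrite !ffunE.
- by move=> x; apply/ffunP => g; rewrite !ffunE mulg1.
- by move=> h h' x; apply/ffunP => g; rewrite !ffunE mulgA.
- move=> a h w Qw chi Cchi.
  under eq_bigr do rewrite !ffunE scalerBr scalerA mulrC -scalerA.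
  rewrite sumrB -scaler_sumr Qw // scaler0 subr0.
  rewrite (reindex_inj (mulIg h^-1%g)) /=.
  under eq_bigr do rewrite mulgKV Cchi.2 mulrC -scalerA.
  by rewrite -scaler_sumr Qw // scaler0.
- move=> chi Cchi; apply: contrapT => ne; apply: none; exists chi => //.
  by under eq_bigr do rewrite -[f _](ffunE f).
- by move=> e; apply: nf; move/ffunP/(_ g0): e; rewrite !ffunE.
have wE g : w g = chi g *: w 1%g.
  by have /ffunP/(_ 1%g) := ww g; rewrite !ffunE mul1g.
(* Since [w] equals [chi] times [w 1], its Fourier coefficient at the inverse of [chi] is [|G|]
   times [w 1]. Its vanishing forces [w = 0] in characteristic zero. *)
have := Qw _ (group_char_inv Cchi).
under eq_bigr do rewrite wE scalerA mulVf ?group_char_neq0 // scale1r.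
rewrite sumr_const -scaler_nat => /eqP; rewrite scaler_eq0.
rewrite (negPf (card_group_neq0 gT ch0)) => /eqP w1.
by apply: nw; apply/ffunP => g; rewrite wE w1 scaler0 ffunE.
Qed.

(** * Monomials up to scalars *)

Section UpToScalar.
Variables (k : fieldType) (A : algType k).
Implicit Types a b c : A.

(** Reordering a monomial costs only invertible scalars, and mostly only the vanishing of monomials
    matters. Working up to such scalars avoids tracking powers of the braiding. *)
Definition associate a b := exists2 e : k, e != 0 & a = e *: b.

Lemma associate_refl a : associate a a.
Proof. by exists 1; rewrite ?oner_neq0 ?scale1r. Qed.

Lemma associate_sym a b : associate a b -> associate b a.
Proof.
by case=> e e0 ->; exists e^-1; rewrite ?invr_neq0 // scalerA mulVf ?scale1r.
Qed.

Lemma associate_trans b a c : associate a b -> associate b c -> associate a c.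
Proof.
by case=> e e0 -> [d d0 ->]; exists (e * d); rewrite ?mulf_neq0 // scalerA.
Qed.

Lemma associate_mul a a' b b' :
  associate a a' -> associate b b' -> associate (a * b) (a' * b').
Proof.
case=> e e0 -> [d d0 ->]; exists (e * d); rewrite ?mulf_neq0 //.
by rewrite -scalerAl -scalerAr scalerA.
Qed.

Definition qcommute a b := associate (a * b) (b * a).

Lemma qcommute_sym a b : qcommute a b -> qcommute b a.
Proof. exact: associate_sym. Qed.

Lemma qcommute1 a : qcommute a 1.
Proof. by rewrite /qcommute mulr1 mul1r; exact: associate_refl. Qed.

Lemma qcommuteM a b c : qcommute a b -> qcommute a c -> qcommute a (b * c).
Proof.
move=> ab ac; apply: (@associate_trans (b * (a * c))).
  by rewrite !mulrA; exact/associate_mul/associate_refl.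
by rewrite -mulrA; exact/associate_mul/ac/associate_refl.
Qed.

Lemma qcommuteX a b n : qcommute a b -> qcommute a (b ^+ n).
Proof.
move=> ab; elim: n => [|n IHn]; first exact: qcommute1.
by rewrite exprS; exact: qcommuteM.
Qed.

Lemma qcommute_prod (I : Type) (r : seq I) (F : I -> A) a :
  (forall i, qcommute a (F i)) -> qcommute a (\prod_(i <- r) F i).
Proof.
move=> aF; elim/big_ind: _ => //; first exact: qcommute1.
by move=> *; exact: qcommuteM.
Qed.

Lemma prod_associate_split (I : Type) (r : seq I) (F F' : I -> A) :
  (forall i j, qcommute (F i) (F' j)) ->
  associate (\prod_(i <- r) (F i * F' i))
            ((\prod_(i <- r) F i) * (\prod_(i <- r) F' i)).
Proof.
move=> FF'; elim: r => [|i r IHr].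
  by rewrite !big_nil mulr1; exact: associate_refl.
rewrite !big_cons -!mulrA; apply: associate_mul; first exact: associate_refl.
apply: associate_trans (associate_mul (associate_refl _) IHr) _.
rewrite !mulrA; apply: associate_mul (associate_refl _).
by apply/qcommute_sym/qcommute_sym/qcommute_prod => j; exact/qcommute_sym.
Qed.

(** Permutations of a sequence are generated by exchanges of adjacent blocks, and two blocks of
    pairwise q-commuting factors q-commute. *)
Lemma prod_associate_perm (I : eqType) (r s : seq I) (F : I -> A) :
  (forall i j, qcommute (F i) (F j)) -> perm_eq r s ->
  associate (\prod_(i <- r) F i) (\prod_(i <- s) F i).
Proof.
move=> FF rs; pose P t := associate (\prod_(i <- r) F i) (\prod_(i <- t) F i).
apply: (@catCA_perm_ind _ P _ r s rs (associate_refl _)) => s1 s2 s3 h.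
apply: associate_trans h _; rewrite !big_cat /= !mulrA.
apply: associate_mul (associate_refl _).
by apply: qcommute_prod => i; apply/qcommute_sym/qcommute_prod.
Qed.

Lemma prod_eq0 (I : eqType) (r : seq I) (F : I -> A) i :
  i \in r -> F i = 0 -> \prod_(j <- r) F j = 0.
Proof.
move=> + Fi0; elim: r => // j r IHr; rewrite inE big_cons.
by case/orP=> [/eqP <-|/IHr ->]; rewrite ?Fi0 ?mul0r ?mulr0.
Qed.

End UpToScalar.

Section Monomials.
Variables (k : closedFieldType) (gT : finGroupType) (theta : nat).
Variables (D : qls_datum k gT theta) (A : algType k).
Variables (u : gT -> A) (y : 'I_theta -> A).

Definition monomial (al : 'I_theta -> nat) : A := \prod_(i < theta) y i ^+ al i.

Lemma eq_monomial al be : al =1 be -> monomial al = monomial be.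
Proof. by move=> e; apply: eq_bigr => i _; rewrite e. Qed.

Lemma monomial0 : monomial (fun _ => 0%N) = 1.
Proof. by rewrite /monomial big1. Qed.

Lemma monomial1 i : monomial (fun j => (j == i) : nat) = y i.
Proof.
rewrite /monomial; have: i \in index_enum 'I_theta by exact: mem_index_enum.
have := index_enum_uniq 'I_theta; elim: (index_enum _) => // j r IHr /=.
case/andP=> jr ur; rewrite inE big_cons; have [eij _|ij /= ir] := eqVneq i j.
  subst j.
  rewrite big_seq big1 ?mulr1 ?eqxx // => l lr.
  by have [e|] := eqVneq l i => //; rewrite -e lr in jr.
by rewrite IHr // mul1r.
Qed.

Lemma top_monomialE :
  top_monomial D y = monomial (fun i => (qm D i).-1).
Proof. by []. Qed.

Definition monomial_char (al : 'I_theta -> nat) (g : gT) : k :=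
  \prod_(i < theta) qchi D i g ^+ al i.

Lemma monomial_charP al : group_char (monomial_char al).
Proof. by apply: group_char_prod => i; apply/group_char_exp/qchi_char. Qed.

Hypothesis rel : qls_relations D u y.

Lemma grouplike1 : u 1%g = 1. Proof. by case: rel => - []. Qed.
Lemma grouplikeM g h : u (g * h)%g = u g * u h.
Proof. by case: rel => - []. Qed.
Lemma u_y g i : u g * y i = qchi D i g *: (y i * u g).
Proof. by case: rel. Qed.
Lemma y_nilp i : y i ^+ qm D i = 0. Proof. by case: rel. Qed.

Lemma y_qcommute i j : qcommute (y i) (y j).
Proof.
have [->|ij] := eqVneq i j; first exact: associate_refl.
exists (qchi D j (qg D i)); last by case: rel => _ _ _ ->.
exact/group_char_neq0/qchi_char.
Qed.

Lemma yX_qcommute i j a b : qcommute (y i ^+ a) (y j ^+ b).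
Proof.
by apply/qcommuteX/qcommute_sym/qcommuteX/y_qcommute.
Qed.

Lemma u_monomial g al :
  u g * monomial al = monomial_char al g *: (monomial al * u g).
Proof.
rewrite /monomial /monomial_char.
elim: (index_enum _) => [|i r IHr].
  by rewrite !big_nil mulr1 mul1r scale1r.
have uyX n : u g * y i ^+ n = qchi D i g ^+ n *: (y i ^+ n * u g).
  elim: n => [|n IHn]; first by rewrite !expr0 mulr1 mul1r scale1r.
  rewrite !exprSr mulrA IHn -scalerAl -[X in _ *: X]mulrA u_y.
  by rewrite -scalerAr scalerA mulrA.
rewrite !big_cons mulrA uyX -scalerAl -[X in _ *: X]mulrA IHr.
by rewrite -scalerAr scalerA mulrA.
Qed.

Lemma monomialM al be :
  associate (monomial al * monomial be) (monomial (fun i => al i + be i)%N).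
Proof.
apply: associate_sym; rewrite /monomial.
under eq_bigr do rewrite exprD.
by apply: prod_associate_split => i j; exact: yX_qcommute.
Qed.

Lemma monomial_vanish al i : (qm D i <= al i)%N -> monomial al = 0.
Proof.
move=> le; apply: (@prod_eq0 _ _ _ _ _ i); first exact: mem_index_enum.
by rewrite -(subnK le) exprD y_nilp mulr0.
Qed.

End Monomials.

(** * Generation by the presentation, and spanning by ordered monomials *)

Section Generated.
Variables (k : fieldType) (A : algType k) (X : A -> Prop).

Inductive generated : A -> Prop :=
| generated_gen a of X a : generated a
| generated1 : generated 1
| generatedP c a b of generated a & generated b : generated (c *: a + b)
| generatedM a b of generated a & generated b : generated (a * b).

Definition generated_pred : {pred A} := fun a => `[< generated a >].

Lemma generated_subalg : subalg_closed generated_pred.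
Proof.
split=> [|c a b /asboolP Ga /asboolP Gb|a b /asboolP Ga /asboolP Gb];
  apply/asboolP; [exact: generated1|exact: generatedP|exact: generatedM].
Qed.

HB.instance Definition _ :=
  GRing.isSubalgClosed.Build k A generated_pred generated_subalg.

(** Packaged as an algebra in its own right, so that it can serve as a target of the universal
    property. *)
Definition subalgebra := {a | generated_pred a}.
HB.instance Definition _ := [isSub of subalgebra for @sval A generated_pred].
HB.instance Definition _ := [Choice of subalgebra by <:].
HB.instance Definition _ := [SubChoice_isSubAlgebra of subalgebra by <:].

Definition subalgebra_val : subalgebra -> A := val.
HB.instance Definition _ := GRing.isZmodMorphism.Build subalgebra A
  subalgebra_val (fun a b => erefl).
HB.instance Definition _ := GRing.isMonoidMorphism.Build subalgebra A
  subalgebra_val (erefl, fun a b => erefl).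
HB.instance Definition _ := GRing.isScalable.Build k subalgebra A *:%R
  subalgebra_val (fun c a => erefl).

End Generated.

Section Presented.
Variables (k : closedFieldType) (gT : finGroupType) (theta : nat).
Variables (D : qls_datum k gT theta) (A : algType k).
Variables (u : gT -> A) (y : 'I_theta -> A).
Hypothesis pres : qls_presented D u y.

(* The universal property maps A to its subalgebra generated by the u g and y i;
   composing with the inclusion gives the identity. *)
Lemma presented_generated a :
  generated (fun b => (exists g, b = u g) \/ (exists i, b = y i)) a.
Proof.
set X := fun b => _; pose S := subalgebra X.
have [[[grouplike1 grouplikeM] uy yn yy] univ] := pres.
have Gu g : generated_pred X (u g).
  by apply/asboolP/generated_gen; left; exists g.
have Gy i : generated_pred X (y i).
  by apply/asboolP/generated_gen; right; exists i.
pose u' g : S := Sub (u g) (Gu g); pose y' i : S := Sub (y i) (Gy i).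
have rel' : qls_relations D u' y'.
  split=> [|g i|i|i j ij]; [split=> [|g h]| | |]; apply: val_inj.
  - by rewrite /= grouplike1.
  - by rewrite /= grouplikeM.
  - by rewrite /= uy.
  - by rewrite rmorphXn /= yn.
  - by rewrite /= yy.
have [f [[fu fy] _]] := univ S u' y' rel'.
have [h [_ hE]] := univ A u y (proj1 pres).
pose vf : {lrmorphism A -> A} := @subalgebra_val _ _ X \o f.
have <- : vf a = a.
  rewrite (hE vf) => [||i] /=.
  - by rewrite -(hE idfun).
  - by move=> g; rewrite fu.
  - by rewrite fy.
by apply/asboolP/(valP (f a)).
Qed.

Lemma presented_ind (P : A -> Prop) :
  (forall g, P (u g)) -> (forall i, P (y i)) ->
  (forall c a b, P a -> P b -> P (c *: a + b)) ->
  (forall a b, P a -> P b -> P (a * b)) -> forall a, P a.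
Proof.
move=> Pu Py PD PM a; elim: (presented_generated a) => {a}.
- by move=> a [[g ->]|[i ->]].
- by have [[[<- _] _ _ _] _] := pres.
- by move=> c a b _ Pa _ Pb; exact: PD.
- by move=> a b _ Pa _ Pb; exact: PM.
Qed.

(** The bounded exponents form a finite type: they index finite sums over [B] and the coordinates of
    the module constructed below. *)
Definition exponents := {dffun forall i : 'I_theta, 'I_(qm D i)}.

Definition basis_elt (al : exponents) (g : gT) : A :=
  monomial y (fun i => al i : nat) * u g.

Lemma monomial_basis (al : 'I_theta -> nat) :
  monomial y al = 0 \/ exists be, forall g, monomial y al * u g = basis_elt be g.
Proof.
have [h|] := EM (forall i, (al i < qm D i)%N).
  right; exists [ffun i => Ordinal (h i)] => g; congr (_ * _).
  by apply: eq_monomial => i; rewrite ffunE.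
move=> /existsNP [i /negP]; rewrite -leqNgt => le; left.
exact: (monomial_vanish (proj1 pres) le).
Qed.

Lemma basis_span a : exists f : exponents -> gT -> k,
  a = \sum_al \sum_g f al g *: basis_elt al g.
Proof.
pose span a := exists f : exponents -> gT -> k,
  a = \sum_al \sum_g f al g *: basis_elt al g.
have spanP c b d : span b -> span d -> span (c *: b + d).
  move=> [f ->] [f' ->]; exists (fun al g => c * f al g + f' al g).
  rewrite scaler_sumr -big_split; apply: eq_bigr => al _.
  rewrite scaler_sumr -big_split; apply: eq_bigr => g _.
  by rewrite /= scalerDl scalerA.
have span0 : span 0.
  exists (fun _ _ => 0); rewrite big1 // => al _.
  by rewrite big1 // => g _; rewrite scale0r.
have spanZ c b : span b -> span (c *: b).
  by move=> sb; rewrite -[_ *: _]addr0; exact: spanP.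
have span_sum I (r : seq I) F :
    (forall i, span (F i)) -> span (\sum_(i <- r) F i).
  move=> sF; elim/big_ind: _ => // b d sb sd.
  by rewrite -[b]scale1r; exact: spanP.
have span_mono al g : span (monomial y al * u g).
  have [->|[be ->]] := monomial_basis al; first by rewrite mul0r.
  exists (fun al h => ((al == be) && (h == g))%:R).
  rewrite (bigD1 be) //= (bigD1 g) //= !eqxx scale1r !big1 ?addr0 //.
  - by move=> de /negPf ->; rewrite big1 // => h _; rewrite scale0r.
  - by move=> h /negPf ->; rewrite scale0r.
(* Strengthened for the induction on [a]: left multiplication by [a] maps every monomial into the
   span. The monomial 1 gives the claim. *)
suff all_span : forall al g, span (a * (monomial y al * u g)).
  have := all_span (fun _ => 0%N) 1%g.
  by rewrite monomial0 (grouplike1 (proj1 pres)) !mulr1.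
elim/presented_ind: a => [h|i|c a b IHa IHb|a b IHa IHb] al g.
- rewrite mulrA (u_monomial (proj1 pres)) -scalerAl -mulrA.
  rewrite -(grouplikeM (proj1 pres)).
  exact: spanZ.
- rewrite mulrA -{1}(monomial1 y i).
  have [c c0 ->] := monomialM (proj1 pres) (fun j => (j == i) : nat) al.
  by rewrite -scalerAl; exact: spanZ.
- by rewrite mulrDl -scalerAl; exact: spanP.
- rewrite -mulrA; have [f ->] := IHb al g; rewrite mulr_sumr.
  apply: (span_sum) => be; rewrite mulr_sumr; apply: span_sum => h.
  by rewrite -scalerAr; exact/spanZ/IHa.
Qed.

End Presented.

(** * Nonvanishing of the elements t_chi *)

Section ColumnOperators.
Variables (k : fieldType) (T : finType) (t0 : T).

(** The size is written as a successor so that the square matrices form a nonzero algebra, a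
    possible target of the universal property; [t0] makes this size equal to [#|T|]. *)
Let N := #|T|.-1.
Let cardN : N.+1 = #|T|. Proof. by apply/prednK/card_gt0P; exists t0. Qed.

Definition column_vector (t : T) : 'cV[k]_N.+1 :=
  delta_mx (cast_ord (esym cardN) (enum_rank t)) 0.

Definition column_operator (f : T -> 'cV[k]_N.+1) : 'M[k]_N.+1 :=
  \matrix_(i, j) f (enum_val (cast_ord cardN j)) i 0.

Lemma column_operatorE f t : column_operator f *m column_vector t = f t.
Proof.
rewrite -colE; apply/matrixP => i j; rewrite !mxE ord1.
by rewrite cast_ordKV enum_rankK.
Qed.

Lemma column_vector_neq0 t : column_vector t <> 0.
Proof.
move/matrixP/(_ (cast_ord (esym cardN) (enum_rank t)) 0).
by rewrite !mxE !eqxx; move/eqP; rewrite oner_eq0.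
Qed.

Lemma column_operator_ext (A B : 'M[k]_N.+1) :
  (forall t, A *m column_vector t = B *m column_vector t) -> A = B.
Proof.
move=> AB; apply/matrixP => i j.
have := AB (enum_val (cast_ord cardN j)).
rewrite -!colE enum_valK cast_ordK.
by move/matrixP/(_ i 0); rewrite !mxE.
Qed.

End ColumnOperators.

(* The Verma-type module with basis the monomials x^al v, where v has weight
   psi. *)
Section MonomialModule.
Variables (k : closedFieldType) (gT : finGroupType) (theta : nat).
Variables (D : qls_datum k gT theta) (psi : gT -> k).
Hypothesis psi_char : group_char psi.
Implicit Types (al : 'I_theta -> nat) (i j : 'I_theta).

Let T := exponents D.

Let qm_gt0 i : (0 < qm D i)%N.
Proof. exact: leq_trans (qm_ge2 D i). Qed.

Definition zero_exponents : T := [ffun i => Ordinal (qm_gt0 i)].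

Let W := 'cV[k]_(#|T|.-1.+1).
Let E := 'M[k]_(#|T|.-1.+1).

(** The default value 0 for exponents out of bounds builds the nilpotency of the [x_i] into the
    module, and lets [al] be an arbitrary function. *)
Definition monomial_vector (al : 'I_theta -> nat) : W :=
  if [pick t : T | [forall i, t i == al i :> nat]] is Some t
  then column_vector k zero_exponents t else 0.

Lemma monomial_vector_basis (t : T) :
  monomial_vector (fun i => t i) = column_vector k zero_exponents t.
Proof.
rewrite /monomial_vector; case: pickP => [s /forallP st|/(_ t)/forallP[] i //].
by suff -> : s = t; [|apply/ffunP => i; apply: val_inj; exact/eqP/st].
Qed.

Lemma monomial_vector_vanish al i :
  (qm D i <= al i)%N -> monomial_vector al = 0.
Proof.
rewrite /monomial_vector; case: pickP => // t /forallP/(_ i)/eqP <-.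
by rewrite leqNgt ltn_ord.
Qed.

Lemma monomial_vector_neq0 al :
  (forall i, al i < qm D i)%N -> monomial_vector al <> 0.
Proof.
move=> h; pose t : T := [ffun i => Ordinal (h i)].
have -> : al = (fun i => t i) by apply/funext => i; rewrite ffunE.
by rewrite monomial_vector_basis; exact: column_vector_neq0.
Qed.

Definition incr (al : 'I_theta -> nat) (i : 'I_theta) n : 'I_theta -> nat :=
  fun j => (al j + (j == i) * n)%N.

(* The cost of moving x_i to its place in x^al, past the x_j with j < i. *)
Definition braiding_scalar (al : 'I_theta -> nat) (i : 'I_theta) : k :=
  \prod_(j < theta | (j < i)%N) qchi D j (qg D i) ^+ al j.

Definition mod_y i : E := column_operator (T := T) zero_exponents (fun t =>
  braiding_scalar (fun j => t j) i *: monomial_vector (incr (fun j => t j) i 1)).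

Definition mod_u g : E := column_operator (T := T) zero_exponents (fun t =>
  (psi g * monomial_char D (fun j => t j) g) *: monomial_vector (fun j => t j)).

Lemma monomial_vectorP al :
  (exists t : T, al = (fun i => t i)) \/ exists i, (qm D i <= al i)%N.
Proof.
have [h|/existsNP [i /negP]] := EM (forall i, (al i < qm D i)%N).
  by left; exists [ffun i => Ordinal (h i)]; apply: funext => i /=; rewrite ffunE.
by rewrite -leqNgt; right; exists i.
Qed.

Lemma mod_yE i al : mod_y i *m monomial_vector al =
  braiding_scalar al i *: monomial_vector (incr al i 1).
Proof.
have [[t ->]|[j le]] := monomial_vectorP al.
  by rewrite {1}monomial_vector_basis column_operatorE.
rewrite !(@monomial_vector_vanish _ j) ?mulmx0 ?scaler0 //.
exact: leq_trans (leq_addr _ _).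
Qed.

Lemma mod_uE g al : mod_u g *m monomial_vector al =
  (psi g * monomial_char D al g) *: monomial_vector al.
Proof.
have [[t ->]|[j le]] := monomial_vectorP al.
  by rewrite {1}monomial_vector_basis column_operatorE.
by rewrite !(@monomial_vector_vanish _ j) ?mulmx0 ?scaler0.
Qed.

Lemma monomial_operator_ext (A B : E) :
  (forall al, A *m monomial_vector al = B *m monomial_vector al) -> A = B.
Proof.
move=> AB; apply: (@column_operator_ext _ _ zero_exponents) => t.
by rewrite -monomial_vector_basis.
Qed.

Lemma mod_yX i n al : exists2 e : k, e != 0 &
  mod_y i ^+ n *m monomial_vector al = e *: monomial_vector (incr al i n).
Proof.
elim: n => [|n [e e0 IHn]].
  exists 1; rewrite ?oner_neq0 // expr0 mul1mx scale1r; congr monomial_vector.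
  by apply/funext => j; rewrite /incr muln0 addn0.
exists (e * braiding_scalar (incr al i n) i).
  rewrite mulf_neq0 //; apply/prodf_neq0 => j _.
  by rewrite expf_neq0 // (group_char_neq0 _ (qchi_char D j)).
rewrite exprS -mulmxA IHn -scalemxAr mod_yE scalerA; congr (_ *: monomial_vector _).
by apply/funext => j; rewrite /incr -addnA -mulnDr addn1.
Qed.

Lemma monomial_char_incr al i g :
  monomial_char D (incr al i 1) g = qchi D i g * monomial_char D al g.
Proof.
rewrite /monomial_char /incr (bigD1 i) //= [X in _ = _ * X](bigD1 i) //=.
rewrite eqxx addn1 exprS -mulrA; congr (_ * (_ * _)).
by apply: eq_bigr => j /negPf ->; rewrite addn0.
Qed.

Lemma braiding_scalar_incr al i j : braiding_scalar (incr al j 1) i =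
  (if (j < i)%N then qchi D j (qg D i) else 1) * braiding_scalar al i.
Proof.
rewrite /braiding_scalar /incr; case: ifP => ji.
  rewrite (bigD1 j) //= [X in _ = _ * X](bigD1 j) //= eqxx addn1 exprS -mulrA.
  congr (_ * (_ * _)).
  by apply: eq_bigr => l /andP [_ /negPf ->]; rewrite addn0.
rewrite mul1r; apply: eq_bigr => l li; case: eqVneq => [lj|_].
  by rewrite -lj li in ji.
by rewrite addn0.
Qed.

Lemma incrC al i j : incr (incr al i 1) j 1 = incr (incr al j 1) i 1.
Proof. by apply/funext => l; rewrite /incr addnAC. Qed.

Lemma mod_relations : qls_relations D mod_u mod_y.
Proof.
have [p1 pM] := psi_char.
split=> [|g i|i|i j ij]; [split=> [|g h]| | |];
  apply: monomial_operator_ext => al.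
- by rewrite mod_uE p1 (monomial_charP D al).1 mul1r scale1r mul1mx.
- rewrite mod_uE -mulmxA mod_uE -scalemxAr mod_uE scalerA pM.
  by rewrite (monomial_charP D al).2 mulrACA [in RHS]mulrC.
- rewrite -scalemxAl -!mulmxA mod_yE mod_uE -!scalemxAr mod_uE mod_yE !scalerA.
  by rewrite monomial_char_incr [in LHS]mulrC mulrCA.
- have [e _ ->] := mod_yX i (qm D i) al.
  rewrite (@monomial_vector_vanish _ i) ?scaler0 ?mul0mx //.
  by rewrite /incr eqxx mul1n leq_addl.
- rewrite -scalemxAl -!mulmxA !mod_yE -!scalemxAr !mod_yE !scalerA.
  rewrite incrC !braiding_scalar_incr; congr (_ *: _).
  set bi := braiding_scalar al i; set bj := braiding_scalar al j.
  (* If [i < j], a factor [qchi i (qg j)] arises on the right and cancels against [qchi j (qg i)] by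
     the braiding condition. If [j < i], the factor [qchi j (qg i)] arises on the left, as
     required. *)
  have [lt|gt|e] := ltngtP i j; last by rewrite (val_inj e) eqxx in ij.
    rewrite mul1r mulrACA [qchi D j _ * qchi D i _]mulrC qchi_braid //.
    by rewrite mul1r mulrC.
  by rewrite mul1r mulrC.
Qed.

Lemma mod_monomial al be : exists2 e : k, e != 0 &
  monomial mod_y al *m monomial_vector be =
  e *: monomial_vector (fun j => be j + al j)%N.
Proof.
rewrite /monomial.
(* The inserted membership factor is 1. It restricts the increment to the indices in the list, which
   makes an induction on the list possible. *)
have -> : (fun j => be j + al j)%N =
    (fun j => be j + (j \in index_enum 'I_theta) * al j)%N.
  by apply: funext => j; rewrite mem_index_enum mul1n.
have := index_enum_uniq 'I_theta; elim: (index_enum _) => [_|i r IHr /=].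
  exists 1; rewrite ?oner_neq0 // big_nil mul1mx scale1r.
  by congr monomial_vector; apply: funext => j; rewrite addn0.
case/andP=> ir /IHr [e e0 rE].
have [d d0 iE] := mod_yX i (al i) (fun j => be j + (j \in r) * al j)%N.
exists (e * d); rewrite ?mulf_neq0 //.
rewrite big_cons -mulmxA rE -scalemxAr iE scalerA; congr (_ *: monomial_vector _).
apply: funext => j; rewrite /incr inE -addnA; congr (_ + _)%N.
by have [->|] := eqVneq j i; rewrite ?(negPf ir) ?addn0.
Qed.

End MonomialModule.

(** In the monomial module, [psi] is chosen so that the top vector has weight inverse to [chi] and
    is thus fixed by [e_chi]. Then [t_chi] sends the generating vector to a nonzero multiple of the
    top vector, and a coordinate of the image is the functional sought. *)
Lemma t_elt_separated (k : closedFieldType) (gT : finGroupType) (theta : nat)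
    (D : qls_datum k gT theta) (A : algType k) (u : gT -> A) (y : 'I_theta -> A)
    (chi : gT -> k) :
  [pchar k] =i pred0 -> qls_presented D u y -> group_char chi ->
  exists phi : {linear A -> k^o}, phi (t_elt D u y chi) != 0.
Proof.
move=> ch0 [_ univ] Cchi.
pose top i := (qm D i).-1.
have Ctop := monomial_charP D top.
pose psi g := (chi g * monomial_char D top g)^-1.
have Cpsi : group_char psi by apply/group_char_inv/group_char_mul.
have [f [[fu fy] _]] := univ _ _ _ (mod_relations D Cpsi).
have nz : monomial_vector D top <> 0.
  apply: monomial_vector_neq0 => i.
  by rewrite ltn_predL; exact: leq_trans (qm_ge2 D i).
have [i nzi] : exists i, monomial_vector D top i 0 != 0.
  apply: contrapT => /forallNP h; apply: nz; apply/matrixP => i j.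
  by rewrite ord1 mxE; apply/eqP; apply: contraT => /h.
pose phi a : k^o := (f a *m monomial_vector D (fun _ => 0%N)) i 0.
have phi_lin : linear phi.
  by move=> c a b; rewrite /phi linearP mulmxDl -scalemxAl !mxE.
pose Phi : {linear A -> k^o} :=
  HB.pack phi (GRing.isLinear.Build _ _ _ _ phi phi_lin).
exists Phi; rewrite /= /phi /t_elt rmorphM top_monomialE rmorph_prod /=.
under eq_bigr do rewrite rmorphXn /= fy.
have [e e0 eE] := mod_monomial D top (fun _ => 0%N).
rewrite -mulmxA eE -scalemxAr /char_idem linearZ linear_sum /=.
under eq_bigr do rewrite linearZ /= fu.
rewrite -scalemxAl mulmx_suml.
have -> : (fun j => 0 + top j)%N = top by [].
under eq_bigr => g _.
  rewrite -scalemxAl mod_uE scalerA mulrCA mulVf ?scale1r; last first.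
    exact: (group_char_neq0 g (group_char_mul Cchi Ctop)).
over.
by rewrite sumr_const -scaler_nat !mxE !mulf_neq0 ?invr_eq0 ?card_group_neq0.
Qed.

Lemma linear_funP (k : pzRingType) (U V : lmodType k) (f : U -> V) :
  linear f -> exists F : {linear U -> V}, F =1 f.
Proof.
move=> lf; pose F : {linear U -> V} :=
  HB.pack f (GRing.isLinear.Build _ _ _ _ f lf).
by exists F.
Qed.

(** * Actions and smash products *)

Section ModuleAlgebra.
Variables (k : closedFieldType) (gT : finGroupType) (theta : nat).
Variables (D : qls_datum k gT theta) (B : algType k) (Hs : hopf_algebra B).
Variables (iota : gT -> B) (x : 'I_theta -> B).
Hypothesis B_bos : qls_bosonization D Hs iota x.
Variables (R : algType k) (M : module_algebra Hs R).

Let pres := bos_presented B_bos.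
Let rel := proj1 pres.

Lemma linear_char_idem (V : lmodType k) (L : B -> V) (chi : gT -> k) h :
  linear L ->
  L (char_idem iota chi * h) = #|gT|%:R^-1 *: \sum_g chi g *: L (iota g * h).
Proof.
case/linear_funP=> F FE.
rewrite -FE /char_idem -scalerAl linearZ mulr_suml linear_sum /=.
by congr (_ *: _); apply: eq_bigr => g _; rewrite -scalerAl linearZ FE.
Qed.

Lemma act_linear r : linear (M^~ r).
Proof. by move=> c a b; exact: actl. Qed.

Lemma act_linear_r h : linear (M h).
Proof. by move=> c a b; exact: actr. Qed.

Lemma act0 h : M h 0 = 0.
Proof. by have := bilZr (act_bilinear M) 0 h 0; rewrite !scale0r. Qed.

Lemma act0l r : M 0 r = 0.
Proof. by have := bilZl (act_bilinear M) 0 0 r; rewrite !scale0r. Qed.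

Lemma actZr h c r : M h (c *: r) = c *: M h r.
Proof. exact: (bilZr (act_bilinear M)). Qed.

Lemma actD h r s : M h (r + s) = M h r + M h s.
Proof. exact: (bilDr (act_bilinear M)). Qed.

Lemma actZl h c r : M (c *: h) r = c *: M h r.
Proof. exact: (bilZl (act_bilinear M)). Qed.

Lemma act_mul_bilinear r s : bilinear (fun a b : B => M a r * M b s).
Proof.
split=> [b|a] c u v /=.
- by rewrite actl mulrDl -scalerAl.
- by rewrite actl mulrDr -scalerAr.
Qed.

Lemma tliftD (V W U : lmodType k) (f : V -> W -> U) y z :
  bilinear f -> tlift f (y + z) = tlift f y + tlift f z.
Proof. by move=> bf; rewrite -[y]scale1r tliftP // !scale1r. Qed.

Lemma act_gM g r s : M (iota g) (r * s) = M (iota g) r * M (iota g) s.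
Proof.
rewrite act_mul (bos_comul_g B_bos) tlift_pure //; exact: act_mul_bilinear.
Qed.

Lemma act_xM i r s :
  M (x i) (r * s) = M (iota (qg D i)) r * M (x i) s + M (x i) r * s.
Proof.
have bf := act_mul_bilinear r s.
by rewrite act_mul (bos_comul_x B_bos) tliftD // !tlift_pure // Defs.act1.
Qed.

Lemma act_g1 g : M (iota g) 1 = 1.
Proof. by rewrite act_one (bos_counit_g B_bos) scale1r. Qed.

Lemma act_x1 i : M (x i) 1 = 0.
Proof.
have /eqP := act_xM i 1 1.
by rewrite !mulr1 act_g1 mul1r -subr_eq subrr eq_sym => /eqP.
Qed.

(** The top monomial passes through [Z] unchanged, and each [g] in the sum defining [e_chi] picks up
    [mu g], so [chi] becomes [chi mu]. This serves both for right multiplication inside [R] and for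
    maps from [R] to [R # B]. *)
Lemma t_elt_intertwine (V : lmodType k) (L : B -> V -> V) (Z : R -> V)
    (mu chi : gT -> k) :
  (forall v, linear (L^~ v)) -> (forall v, L 1 v = v) ->
  (forall a b v, L (a * b) v = L a (L b v)) -> linear Z ->
  (forall i r, L (x i) (Z r) = Z (M (x i) r)) ->
  (forall g r, L (iota g) (Z r) = mu g *: Z (M (iota g) r)) ->
  forall r, L (t_elt D iota x chi) (Z r) =
            Z (M (t_elt D iota x (fun g => chi g * mu g)) r).
Proof.
move=> L_lin L1 LM Z_lin Lx Lg r.
have [ZZ ZE] := linear_funP Z_lin.
pose P b := forall r, L b (Z r) = Z (M b r).
have P1 : P 1 by move=> s; rewrite L1 Defs.act1.
have PM a b : P a -> P b -> P (a * b) by move=> Pa Pb s; rewrite LM Pb Pa Defs.actM.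
have Ptop : P (top_monomial D x).
  rewrite /top_monomial; elim/big_ind: _ => // i _.
  by elim: (_.-1) => [|n IHn]; rewrite ?expr0 // exprS; apply: PM => // s.
rewrite /t_elt (linear_char_idem _ _ (L_lin _)).
rewrite (linear_char_idem _ _ (act_linear r)).
rewrite -[RHS]ZE linearZ [ZZ _]linear_sum /=; congr (_ *: _).
by apply: eq_bigr => g _; rewrite LM Ptop Lg -Defs.actM scalerA [RHS]linearZ /= ZE.
Qed.

Implicit Types (y z : smash M).

(** A pure tensor typed as an element of the smash product, so that [*] is the smash
    multiplication. *)
Definition spure (r : R) (h : B) : smash M := r ⊗ h.

Lemma spure_linear_l h : linear (spure^~ h).
Proof. by move=> c r s; rewrite /spure pureDl pureZl. Qed.

Lemma spure_linear_r r : linear (spure r).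
Proof. by move=> c h l; rewrite /spure pureDr pureZr. Qed.

Lemma spure0 h : spure 0 h = 0.
Proof. by rewrite /spure -[0 in LHS](scale0r (0 : R)) pureZl scale0r. Qed.

Lemma spure0r r : spure r 0 = 0.
Proof. by rewrite /spure -[0 in LHS](scale0r (0 : B)) pureZr scale0r. Qed.

Lemma spureE r h s l : spure r h * spure s l =
  tlift (fun h1 h2 => spure (r * M h1 s) (h2 * l)) (comul Hs h).
Proof. exact: smash_mulE. Qed.

Lemma spure_mulr r s h : spure r 1 * spure s h = spure (r * s) h.
Proof.
rewrite spureE comul1 tlift_pure; last exact: smash_aux_bilin.
by rewrite Defs.act1 mul1r.
Qed.

Lemma spure_mulB r h l : spure r h * spure 1 l = spure r (h * l).
Proof.
have [S SE] := linear_funP (spure_linear_r r).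
rewrite spureE -[in RHS](counitl Hs h) /tlift mulr_suml -[RHS]SE [S _]linear_sum.
apply: eq_bigr => p _; rewrite act_one -scalerAr mulr1 -scalerAl linearZ /= SE.
exact: pureZl.
Qed.

Lemma spure_factor r h : spure r h = spure r 1 * spure 1 h.
Proof. by rewrite spure_mulr mulr1. Qed.

Lemma spure_g g s l :
  spure 1 (iota g) * spure s l = spure (M (iota g) s) (iota g * l).
Proof.
rewrite spureE (bos_comul_g B_bos) tlift_pure; last exact: smash_aux_bilin.
by rewrite mul1r.
Qed.

Lemma spure_x i s l : spure 1 (x i) * spure s l =
  spure (M (iota (qg D i)) s) (x i * l) + spure (M (x i) s) l.
Proof.
have bf := smash_aux_bilin M 1 s l.
by rewrite spureE (bos_comul_x B_bos) tliftD // !tlift_pure // !mul1r.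
Qed.

Lemma smash_mul_linear_l z : linear (fun h => spure 1 h * z).
Proof.
move=> c h l; rewrite /spure pureDr pureZr; exact: smash_mulP.
Qed.

Lemma smash_mulZr c y z : y * (c *: z) = c *: (y * z).
Proof.
have := smash_mulPr (M := M) c y z 0.
by rewrite smash_mulr0 !addr0.
Qed.

Lemma smash_ind (P : smash M -> Prop) :
  P 0 -> (forall y z, P y -> P z -> P (y + z)) ->
  (forall r h, P (spure r h)) -> forall z, P z.
Proof. exact: tens_ind. Qed.

(** Left multiplication by [x_i] reaches only [r], because [x_i] kills [s] and [x_i * l = 0]. The
    group acts on [s # l] by [mu], so [t_elt_intertwine] applies to the map taking [r] to
    [r s # l]. *)
Lemma t_elt_smash (chi mu : gT -> k) (s : R) (l : B) :
  (forall i, M (x i) s = 0) -> (forall i, x i * l = 0) ->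
  (forall g, spure (M (iota g) s) (iota g * l) = mu g *: spure s l) ->
  forall r, spure 1 (t_elt D iota x chi) * spure (r * s) l =
    spure (M (t_elt D iota x (fun g => chi g * mu g)) r * s) l.
Proof.
move=> xs xl gsl.
apply: (@t_elt_intertwine (smash M) (fun h z => spure 1 h * z)
  (fun r => spure (r * s) l) mu chi).
- exact: smash_mul_linear_l.
- by move=> z; rewrite mul1r.
- by move=> h h' z; rewrite mulrA spure_mulB.
- by move=> c r r'; rewrite mulrDl -scalerAl spure_linear_l.
- by move=> i r; rewrite spure_x xl spure0r add0r act_xM xs mulr0 add0r.
- move=> g r; rewrite spure_g act_gM.
  by rewrite -(spure_mulr (M (iota g) r) (M (iota g) s)) gsl smash_mulZr spure_mulr.
Qed.

End ModuleAlgebra.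

(** * Left multiplication on the elements t_chi *)

Section TElements.
Variables (k : closedFieldType) (gT : finGroupType) (theta : nat).
Variables (D : qls_datum k gT theta) (A : algType k).
Variables (u : gT -> A) (y : 'I_theta -> A).
Hypothesis rel : qls_relations D u y.

Lemma u_char_idem chi g :
  group_char chi -> u g * char_idem u chi = (chi g)^-1 *: char_idem u chi.
Proof.
move=> Cchi; rewrite /char_idem -scalerAr scalerA mulrC -scalerA; congr (_ *: _).
rewrite mulr_sumr scaler_sumr [RHS](reindex_inj (mulgI g)) /=.
apply: eq_bigr => h _; rewrite -scalerAr (grouplikeM rel) Cchi.2 scalerA mulrA.
by rewrite mulVf ?mul1r // group_char_neq0.
Qed.

Lemma monomial_char_idem chi al : monomial y al * char_idem u chi =
  char_idem u (fun g => chi g * (monomial_char D al g)^-1) * monomial y al.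
Proof.
rewrite /char_idem -scalerAr -scalerAl mulr_sumr mulr_suml; congr (_ *: _).
apply: eq_bigr => g _; rewrite -scalerAr -scalerAl (u_monomial rel) scalerA.
by rewrite mulfVK // group_char_neq0 //; exact: monomial_charP.
Qed.

Lemma u_t_elt chi g :
  group_char chi -> u g * t_elt D u y chi = (chi g)^-1 *: t_elt D u y chi.
Proof. by move=> Cchi; rewrite /t_elt mulrA u_char_idem // scalerAl. Qed.

Lemma y_top i : y i * top_monomial D y = 0.
Proof.
rewrite top_monomialE -{1}(monomial1 y i).
have [e _ ->] := monomialM rel (fun j => (j == i) : nat) (fun j => (qm D j).-1).
rewrite (monomial_vanish rel (i := i)) ?scaler0 // eqxx add1n prednK //.
exact: leq_trans (qm_ge2 D i).
Qed.

(** Moving [x_i] past [e_chi] only changes the character of the idempotent, and [x_i] then meets the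
    top monomial, where its exponent overflows. *)
Lemma y_t_elt chi i : y i * t_elt D u y chi = 0.
Proof.
rewrite /t_elt -(monomial1 y i) mulrA monomial_char_idem -mulrA monomial1.
by rewrite y_top mulr0.
Qed.

Lemma t_elt_stable (pres : qls_presented D u y) chi a : group_char chi ->
  exists c : k, a * t_elt D u y chi = c *: t_elt D u y chi.
Proof.
move=> Cchi; elim/(presented_ind pres): a => [g|i|c a b|a b].
- by exists (chi g)^-1; exact: u_t_elt.
- by exists 0; rewrite y_t_elt scale0r.
- move=> [ca aE] [cb bE]; exists (c * ca + cb).
  by rewrite mulrDl -scalerAl aE bE scalerA -scalerDl.
- move=> [ca aE] [cb bE]; exists (cb * ca).
  by rewrite -mulrA bE -scalerAr aE scalerA.
Qed.

End TElements.

(** * The equivalences *)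

Section Equivalences.
Variables (k : closedFieldType) (gT : finGroupType) (theta : nat).
Variables (D : qls_datum k gT theta) (B : algType k) (Hs : hopf_algebra B).
Variables (iota : gT -> B) (x : 'I_theta -> B).
Hypothesis B_bos : qls_bosonization D Hs iota x.
Variables (R : algType k) (M : module_algebra Hs R).
Hypothesis k_char0 : [pchar k] =i pred0.

Let pres := bos_presented B_bos.
Let rel := proj1 pres.
Let t := t_elt D iota x.

(** A functional on [B] not vanishing at [t chi] induces a map from [R # B] to [R] that sends
    [p # t chi] to a nonzero multiple of [p]. *)
Lemma spure_t_neq0 p chi : group_char chi -> p <> 0 -> spure M p (t chi) <> 0.
Proof.
move=> Cchi np e.
have [phi nphi] := t_elt_separated k_char0 pres Cchi.
have bf : bilinear (fun (r : R) (b : B) => (phi b : k) *: r).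
  split=> [b|r] c v w /=; first by rewrite scalerDr !scalerA mulrC.
  by rewrite linearP /= scalerDl scalerA.
have := congr1 (tlift (fun (r : R) (b : B) => (phi b : k) *: r)) e.
rewrite (tlift_pure _ _ bf) (tlift_zero bf) => /eqP.
by rewrite scaler_eq0 (negPf nphi) => /eqP.
Qed.

Lemma act_t_top chi r : M (t chi) r = M (char_idem iota chi) (M (top_monomial D x) r).
Proof. by rewrite -Defs.actM. Qed.

Lemma t_act_neq0_of_prime : prime_ring (smash M) ->
  forall chi, group_char chi -> exists r, M (t chi) r <> 0.
Proof.
move=> [_ prim] chi Cchi; apply: contrapT => /forallNP t0.
have {}t0 r : M (t chi) r = 0 by apply: contrapT; exact: t0.
pose one (_ : gT) : k := 1; have C1 : group_char one := group_char1 k gT.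
have one_neq0 : 1 <> 0 :> R by apply/eqP; rewrite oner_eq0.
have nz psi : group_char psi -> spure M 1 (t psi) <> 0.
  by move=> Cpsi; exact: spure_t_neq0.
case: (prim (spure M 1 (t chi)) (spure M 1 (t one))); [|exact: nz..].
move=> c; elim/(@smash_ind _ _ _ _ M): c => [|y z IHy IHz|r h].
- by rewrite mulr0 mul0r.
- by rewrite mulrDr mulrDl IHy IHz addr0.
rewrite -mulrA spure_mulB.
have [c ->] := t_elt_stable rel pres h C1.
have -> : spure M r (c *: t one) = c *: spure M r (t one) by exact: pureZr.
(* Writing [r] as [r * 1] allows [t_elt_smash] with [s = 1], which is invariant; [1 # t one] has
   trivial weight, so [chi] is not shifted. *)
rewrite smash_mulZr -[r]mulr1.
rewrite (t_elt_smash B_bos chi (mu := one)) => [|i|i|g].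
- rewrite (_ : (fun g => chi g * one g) = chi) ?t0 ?mul0r ?spure0 ?scaler0 //.
  by apply: funext => g; rewrite mulr1.
- exact: (act_x1 B_bos).
- exact: (y_t_elt rel).
- by rewrite (act_g1 B_bos) (u_t_elt rel) // invr1 !scale1r.
Qed.

Lemma act_associate (a b : B) r : associate a b -> M b r <> 0 -> M a r <> 0.
Proof.
move=> [e e0 ->] nb; rewrite actZl => /eqP.
by rewrite scaler_eq0 (negPf e0) => /eqP.
Qed.

Lemma killed_flag_of_t_act_neq0 :
  (forall chi, group_char chi -> exists r, M (t chi) r <> 0) ->
  (forall i : 'I_theta, exists r,
     (forall j : 'I_theta, (j < i)%N -> M (x j) r = 0) /\ M (x i) r <> 0) /\
  (forall chi : gT -> k, group_char chi ->
     exists a : R, [/\ a <> 0, forall i, M (x i) a = 0 &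
       forall g : gT, M (iota g) a = chi g^-1%g *: a]).
Proof.
move=> tneq0; split=> [i|chi Cchi].
  have [r tr] := tneq0 _ (group_char1 k gT).
  have {}tr : M (top_monomial D x) r <> 0.
    by move=> e; apply: tr; rewrite act_t_top e act0.
  (* [al] is the top exponent lowered by one at [i], and [d j] is the exponent of the single
     variable [x_j]. *)
  pose al j := ((qm D j).-1 - (j == i))%N; pose d j l : nat := l == j :> 'I_theta.
  have top_gt0 j : (0 < (qm D j).-1)%N by rewrite -subn1 subn_gt0 qm_ge2.
  exists (M (monomial x al) r); split=> [j ji|].
    rewrite -Defs.actM -(monomial1 x j).
    have [e _ ->] := monomialM rel (d j) al.
    rewrite actZl (monomial_vanish rel (i := j)) ?act0l ?scaler0 //.
    rewrite /d /al eqxx (_ : (j == i) = false) ?subn0 ?add1n ?prednK //.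
      exact: leq_trans (qm_ge2 D j).
    by rewrite -val_eqE /= ltn_eqF.
  rewrite -Defs.actM -(monomial1 x i).
  apply: act_associate (monomialM rel (d i) al) _.
  rewrite (_ : monomial x _ = top_monomial D x) // top_monomialE.
  by apply: eq_monomial => j; rewrite /d /al addnC subnK //; case: eqP.
have [r tr] := tneq0 _ Cchi.
exists (M (t chi) r); split=> // [i|g].
  by rewrite -Defs.actM (y_t_elt rel) act0l.
by rewrite -Defs.actM (u_t_elt rel) // actZl group_charV.
Qed.

End Equivalences.

(** * Invariants of the skew derivations and the top monomial *)

Section Invariants.
Variables (k : closedFieldType) (gT : finGroupType) (theta : nat).
Variables (D : qls_datum k gT theta) (B : algType k) (Hs : hopf_algebra B).
Variables (iota : gT -> B) (x : 'I_theta -> B).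
Hypothesis B_bos : qls_bosonization D Hs iota x.
Variables (R : algType k) (M : module_algebra Hs R).
Hypothesis R_domain : GRing.integral_domain_axiom R.

Let pres := bos_presented B_bos.
Let rel := proj1 pres.

Definition invariant_under (r : R) := forall i, M (x i) r = 0.

Lemma mul_neq0 (r s : R) : r <> 0 -> s <> 0 -> r * s <> 0.
Proof. by move=> nr ns /R_domain /orP [] /eqP. Qed.

Lemma act_xC i j r : exists2 c : k, c != 0 &
  M (x i) (M (x j) r) = c *: M (x j) (M (x i) r).
Proof.
have [c c0 e] := y_qcommute rel i j; exists c => //.
by rewrite -!Defs.actM e actZl.
Qed.

Lemma act_xC0 i j r : M (x i) r = 0 -> M (x i) (M (x j) r) = 0.
Proof. by move=> e; have [c _ ->] := act_xC i j r; rewrite e act0 scaler0. Qed.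

Lemma act_gx g i r :
  M (iota g) (M (x i) r) = qchi D i g *: M (x i) (M (iota g) r).
Proof. by rewrite -!Defs.actM (u_y rel) actZl. Qed.

Lemma act_xg g i r :
  M (x i) (M (iota g) r) = (qchi D i g)^-1 *: M (iota g) (M (x i) r).
Proof.
rewrite act_gx scalerA mulVf ?scale1r //.
exact/group_char_neq0/qchi_char.
Qed.

Lemma act_xg0 g i r : M (x i) r = 0 -> M (x i) (M (iota g) r) = 0.
Proof. by move=> e; rewrite act_xg e act0 scaler0. Qed.

Lemma act_g_neq0 g r : r <> 0 -> M (iota g) r <> 0.
Proof.
move=> nr e; apply: nr.
rewrite -[r](Defs.act1 M) -(grouplike1 rel) -(mulVg g) (grouplikeM rel).
by rewrite Defs.actM e act0.
Qed.

Lemma act_x_mul0 i r s :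
  M (x i) r = 0 -> M (x i) s = 0 -> M (x i) (r * s) = 0.
Proof. by move=> r0 s0; rewrite (act_xM B_bos) r0 s0 mulr0 mul0r addr0. Qed.

Lemma act_x_pow0 i r n : M (x i) r = 0 -> M (x i) (r ^+ n) = 0.
Proof.
move=> r0; elim: n => [|n IHn]; first exact: (act_x1 B_bos).
by rewrite exprS; exact: act_x_mul0.
Qed.

Lemma act_iter h n r : iter n (M h) r = M (h ^+ n) r.
Proof.
elim: n => [|n IHn]; first by rewrite Defs.act1.
by rewrite iterS IHn exprS Defs.actM.
Qed.

(** Each [x_i] acts nilpotently, so one takes the last nonzero iterate for each index in turn. The
    [x_j] commute up to scalars, hence what was killed before stays killed. *)
Lemma exists_invariant (Q : R -> Prop) r :
  (forall i s, Q s -> Q (M (x i) s)) -> Q r -> r <> 0 ->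
  exists s, [/\ Q s, s <> 0 & invariant_under s].
Proof.
move=> Qx Qr nr.
suff [s [Qs ns sl]] : exists s, [/\ Q s, s <> 0 &
    forall i, i \in enum 'I_theta -> M (x i) s = 0].
  by exists s; split=> // i; apply: sl; rewrite mem_enum.
elim: (enum _) => [|i l [s [Qs ns sl]]]; first by exists r.
have [||||w [[Qw wl] nw iw]] := @last_iter _ (M (x i))
    (fun s => Q s /\ forall j, j \in l -> M (x j) s = 0) (qm D i) s.
- by move=> w [Qw wl]; split=> [|j /wl]; [exact: Qx|exact: act_xC0].
- by split.
- by [].
- by rewrite act_iter (y_nilp rel) act0l.
exists w; split=> // j; rewrite inE => /orP [/eqP ->|] //; exact: wl.
Qed.

(** Multiplied by [q^-1 - 1], the geometric sum becomes [q^-n - 1], which is nonzero for [n] below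
    the order of [q]. *)
Lemma q_integer_neq0 (q : k) (m n : nat) : m.-primitive_root q ->
  (0 < n < m)%N -> \sum_(j < n) q^-1 ^+ j != 0.
Proof.
move=> qm /andP [n0 nm]; apply/eqP => e.
have := subrX1 q^-1 n; rewrite e mulr0 => /eqP.
rewrite subr_eq0 exprVn invr_eq1 -(prim_order_dvd qm) => /(dvdn_leq n0).
by rewrite leqNgt nm.
Qed.

(* The q-Leibniz rule truncated by x^2(r) = 0. *)
Lemma act_x_leibniz i r s n : invariant_under (M (x i) r) ->
  iter n.+1 (M (x i)) (r * s) =
    iter n.+1 (M (iota (qg D i))) r * iter n.+1 (M (x i)) s +
    (\sum_(j < n.+1) (qchi D i (qg D i))^-1 ^+ j) *:
      (iter n (M (iota (qg D i))) (M (x i) r) * iter n (M (x i)) s).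
Proof.
set X := M (x i); set G := M (iota _); set q := qchi _ _ _; move=> inv.
have GX l : X (iter l G r) = q^-1 ^+ l *: iter l G (X r).
  elim: l => [|l IHl]; first by rewrite scale1r.
  by rewrite /= /X act_xg -/X -/G -/q IHl /G actZr scalerA -exprS.
have X0 l : X (iter l G (X r)) = 0.
  elim: l => [|l IHl]; first exact: inv.
  by rewrite iterS; exact: act_xg0.
elim: n => [|n IHn].
  by rewrite /= big_ord1 scale1r; exact: (act_xM B_bos).
rewrite iterS IHn /X actD actZr !(act_xM B_bos) -/X -/G X0 mul0r addr0 GX.
rewrite -scalerAl -addrA -scalerDl [in RHS]big_ord_recr /=.
by rewrite [in RHS]addrC.
Qed.

(** In the Leibniz formula for [r * r^n] the first term vanishes by induction. What remains is a
    nonzero q-integer times a product of two nonzero invariants, which is nonzero in a domain. *)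
Lemma act_x_pow i r n : invariant_under (M (x i) r) -> M (x i) r <> 0 ->
  (n < qm D i)%N ->
  [/\ M (x i ^+ n.+1) (r ^+ n) = 0, M (x i ^+ n) (r ^+ n) <> 0 &
      invariant_under (M (x i ^+ n) (r ^+ n))].
Proof.
move=> inv nz; rewrite -!act_iter; elim: n => [_|n IHn nm].
  split; rewrite /= ?expr0; first exact: (act_x1 B_bos).
    by apply/eqP; rewrite oner_eq0.
  by move=> j; exact: (act_x1 B_bos).
have [e0 en einv] := IHn (ltnW nm).
have powE : iter n.+1 (M (x i)) (r ^+ n.+1) =
    (\sum_(j < n.+1) (qchi D i (qg D i))^-1 ^+ j) *:
      (iter n (M (iota (qg D i))) (M (x i) r) * iter n (M (x i)) (r ^+ n)).
  by rewrite exprS act_x_leibniz // e0 mulr0 add0r.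
have [Gn Ginv] : iter n (M (iota (qg D i))) (M (x i) r) <> 0 /\
    invariant_under (iter n (M (iota (qg D i))) (M (x i) r)).
  elim: (n) => [|l [Gn Ginv]]; first by split.
  by rewrite iterS; split; [exact: act_g_neq0|move=> j; exact: act_xg0].
have inv' : invariant_under (iter n.+1 (M (x i)) (r ^+ n.+1)).
  by move=> j; rewrite powE actZr act_x_mul0 ?scaler0.
(* The vanishing of the next iterate is the invariance of the present one under [x_i] itself. *)
split=> //; first exact: inv'.
rewrite powE => /eqP; rewrite scaler_eq0.
rewrite (negPf (q_integer_neq0 (n := n.+1) (qm_order D i) nm)) /=.
by move/eqP; exact: mul_neq0.
Qed.

(** For invariant [d] the skew Leibniz rule reduces to [x_i(d s) = g_i(d) x_i(s)], and [g_i(d)] is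
    again invariant. So an invariant factor comes out of any monomial, moved by the product [g] of
    the grouplikes met. *)
Lemma act_mul_invariant (I : Type) (l : seq I) (f : I -> 'I_theta)
    (al : I -> nat) d s : invariant_under d ->
  exists g, M (\prod_(i <- l) x (f i) ^+ al i) (d * s) =
    M (iota g) d * M (\prod_(i <- l) x (f i) ^+ al i) s.
Proof.
pose P h := forall d s, invariant_under d ->
  exists g, M h (d * s) = M (iota g) d * M h s.
move: d s; rewrite -/(P _).
have P1 : P 1 by move=> d s _; exists 1%g; rewrite (grouplike1 rel) !Defs.act1.
have PM h h' : P h -> P h' -> P (h * h').
  move=> Ph Ph' d s dinv; have [g gE] := Ph' d s dinv.
  have [|g' g'E] := Ph (M (iota g) d) (M h' s).
    by move=> j; exact: act_xg0.
  by exists (g' * g)%g; rewrite (grouplikeM rel) !Defs.actM gE g'E.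
elim/big_ind: _ => // i _; elim: (al i) => [|n IHn]; first by rewrite expr0.
rewrite exprS; apply: PM => // d s dinv.
by exists (qg D (f i)); rewrite (act_xM B_bos) dinv mul0r addr0.
Qed.

(** Induction on [l2], with [l1] the indices already passed. For the head [i] the witness is
    [r^(m_i - 1) * s], where [x_i(r)] is a nonzero invariant and [s], killed by [l1] and by [x_i],
    comes from the tail. *)
Lemma flag_top_neq0 (l1 l2 : seq 'I_theta) :
  (forall a i b, l1 ++ l2 = a ++ i :: b ->
     exists r, (forall j, j \in a -> M (x j) r = 0) /\ M (x i) r <> 0) ->
  exists r, (forall j, j \in l1 -> M (x j) r = 0) /\
    M (\prod_(i <- l2) x i ^+ (qm D i).-1) r <> 0.
Proof.
elim: l2 l1 => [|i l2 IHl] l1 flag.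
  exists 1; split=> [j _|]; first exact: (act_x1 B_bos).
  by rewrite big_nil Defs.act1; apply/eqP; rewrite oner_eq0.
have [|s [sl ns]] := IHl (rcons l1 i); first by rewrite cat_rcons.
have [r0 [r0l nr0]] := flag l1 i l2 erefl.
(* The images under [x_i] of elements killed by [l1] are stable under all [x_j], so a nonzero
   invariant can be found among them. *)
pose Q v := exists2 r, forall j, j \in l1 -> M (x j) r = 0 & M (x i) r = v.
have [||c [[r rl rc] nc cinv]] := @exists_invariant Q (M (x i) r0) _ _ nr0.
- move=> j _ [r rl <-]; have [e e0 ->] := act_xC j i r.
  exists (e *: M (x j) r); last by rewrite actZr.
  by move=> h hl; rewrite actZr act_xC0 ?scaler0 ?rl.
- by exists r0.
rewrite -rc in nc cinv.
have m_gt0 : (0 < qm D i)%N by exact: leq_trans (qm_ge2 D i).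
have [|_ dn dinv] := act_x_pow (n := (qm D i).-1) cinv nc.
  by rewrite ltn_predL.
set n := (qm D i).-1 in dn dinv *.
exists (r ^+ n * s); split=> [j jl|].
  apply: act_x_mul0; first by apply: act_x_pow0; exact: rl.
  by apply: sl; rewrite mem_rcons inE jl orbT.
set T := \prod_(j <- l2) x j ^+ (qm D j).-1 in ns *.
rewrite big_cons -/T -/n.
have TC : associate (x i ^+ n * T) (T * x i ^+ n).
  by apply: qcommute_prod => j; exact: (yX_qcommute rel).
(* With [x_i^n] acting first, it meets only [r^n], since [x_i] kills [s]. The result is an invariant
   factor, which then comes out of the action of [T]. *)
apply: act_associate TC _; rewrite Defs.actM.
have -> : M (x i ^+ n) (r ^+ n * s) = M (x i ^+ n) (r ^+ n) * s.
  elim: (n) (r ^+ n) => [|l IHn] p; first by rewrite expr0 !Defs.act1.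
  have si : M (x i) s = 0 by apply: sl; rewrite mem_rcons inE eqxx.
  by rewrite exprS !Defs.actM IHn (act_xM B_bos) si mulr0 add0r.
have [g ->] := @act_mul_invariant _ l2 id (fun j => (qm D j).-1) _ s dinv.
exact/mul_neq0/ns/act_g_neq0.
Qed.

Lemma t_act_neq0_of_flag (s : {perm 'I_theta}) :
  [pchar k] =i pred0 ->
  (forall i : 'I_theta, exists r,
     (forall j : 'I_theta, (j < i)%N -> M (x (s j)) r = 0) /\
     M (x (s i)) r <> 0) ->
  (forall chi : gT -> k, group_char chi ->
     exists a : R, [/\ a <> 0, forall i, M (x i) a = 0 &
       forall g : gT, M (iota g) a = chi g^-1%g *: a]) ->
  forall chi, group_char chi -> exists r, M (t_elt D iota x chi) r <> 0.
Proof.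
move=> k_char0 flag weights chi Cchi.
(* The indices are listed in the order prescribed by [s], so the flag condition on prefixes of this
   list is the given one read through the inverse of [s]. *)
have [|r [_ nr]] := @flag_top_neq0 [::] (map s (enum 'I_theta)).
  move=> a' i b' /(congr1 (map s^-1%g)).
  rewrite cat0s -map_comp map_id_in => [|j _].
    rewrite map_cat /= => e; have [r [rl nr]] := flag ((s^-1)%g i).
    exists r; rewrite permKV in nr; split=> // j ja.
    have := rl ((s^-1)%g j); rewrite permKV; apply.
    (* The enumeration of indices is increasing, so every preimage in the prefix lies strictly below
       that of [i'], here called [i]. *)
    have : sorted ltn (map val (enum 'I_theta)).
      by rewrite val_enum_ord iota_ltn_sorted.
    rewrite e map_cat /= (sorted_pairwise ltn_trans) pairwise_cat.
    case/and3P=> h _ _.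
    move/allrelP: h => /(_ (val ((s^-1)%g j)) (val ((s^-1)%g i))); apply.
      by rewrite -map_comp; apply: map_f.
    by rewrite inE eqxx.
  by rewrite /= permK.
have {}nr : M (top_monomial D x) r <> 0.
  apply: act_associate nr; rewrite /top_monomial.
  apply: prod_associate_perm => [i j|]; first exact: (yX_qcommute rel).
  apply: uniq_perm; first exact: index_enum_uniq.
    by rewrite map_inj_uniq ?enum_uniq //; exact: perm_inj.
  by move=> i; rewrite mem_index_enum -(permKV s i) map_f // mem_enum.
have abelG := qabelian D.
(* The values [t_psi(r)] are, up to [1/|G|], the Fourier coefficients of the orbit map of
   [x^top(r)], so one of them is nonzero. *)
have [|psi Cpsi npsi] := @fourier_coef_neq0 k gT R
  (fun g => M (iota g) (M (top_monomial D x) r)) 1%g k_char0 abelG.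
  by rewrite (grouplike1 rel) Defs.act1.
have {}npsi : M (t_elt D iota x psi) r <> 0.
  rewrite /t_elt (linear_char_idem _ _ _ (act_linear M r)).
  under eq_bigr do rewrite Defs.actM.
  move/eqP; rewrite scaler_eq0 invr_eq0.
  by rewrite (negPf (card_group_neq0 gT k_char0)) => /eqP.
(* Chosen so that [chi la = psi]: for an invariant [a] of weight [la] one gets
   [t_chi(r a) = t_psi(r) a]. *)
pose la g := (chi g)^-1 * psi g.
have Cla : group_char la by apply/group_char_mul/Cpsi/group_char_inv.
have [a [na ainv ga]] := weights _ (group_char_inv Cla).
exists (r * a).
rewrite (t_elt_intertwine D (M := M) (L := M) (Z := fun v => v * a) (mu := la)).
- rewrite (_ : (fun g => chi g * la g) = psi); first exact: mul_neq0.
  by apply: funext => g; rewrite /la mulVKf // group_char_neq0.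
- by move=> v c h h'; exact: actl.
- by move=> v; exact: Defs.act1.
- by move=> h h' v; exact: Defs.actM.
- by move=> c v w; rewrite mulrDl scalerAl.
- by move=> i v; rewrite (act_xM B_bos) ainv mulr0 add0r.
- move=> g v; rewrite (act_gM B_bos) ga (group_charV g Cla) invrK.
  by rewrite -scalerAr.
Qed.

End Invariants.

(** * Reduction to multiples of t_chi, and primeness *)

Section Prime.
Variables (k : closedFieldType) (gT : finGroupType) (theta : nat).
Variables (D : qls_datum k gT theta) (B : algType k) (Hs : hopf_algebra B).
Variables (iota : gT -> B) (x : 'I_theta -> B).
Hypothesis B_bos : qls_bosonization D Hs iota x.
Variables (R : algType k) (M : module_algebra Hs R).
Hypothesis k_char0 : [pchar k] =i pred0.

Let pres := bos_presented B_bos.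
Let rel := proj1 pres.
Let t := t_elt D iota x.

Lemma smash_basis_span (z : smash M) : exists f : exponents D -> gT -> R,
  z = \sum_al \sum_g spure M (f al g) (basis_elt iota x al g).
Proof.
elim/(@smash_ind _ _ _ _ M): z => [|_ _ [f ->] [f' ->]|r h].
- exists (fun _ _ => 0); rewrite big1 // => al _.
  by rewrite big1 // => g _; exact: spure0.
- exists (fun al g => f al g + f' al g); rewrite -big_split.
  apply: eq_bigr => al _; rewrite -big_split; apply: eq_bigr => g _.
  by rewrite /spure pureDl.
have [f ->] := basis_span pres h.
exists (fun al g => f al g *: r).
have [S SE] := linear_funP (spure_linear_r M r).
rewrite -SE linear_sum; apply: eq_bigr => al _.
rewrite linear_sum; apply: eq_bigr => g _.
by rewrite linearZ /= SE /spure pureZl.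
Qed.

(* Multiplying by x^(top - al), for an exponent al of least total degree among
   those occurring in z, leaves only terms in x^top. *)
Lemma smash_reduce (z : smash M) : z <> 0 ->
  exists h p (chi : gT -> k),
    [/\ group_char chi, p <> 0 & z * spure M 1 h = spure M p (t chi)].
Proof.
have [f zE] := smash_basis_span z => nz.
pose P al := [exists g, f al g != 0].
have [al0 Pal0] : exists al, P al.
  apply: contrapT => /forallNP nP; apply: nz; rewrite zE big1 // => al _.
  rewrite big1 // => g _; have [->|fg] := eqVneq (f al g) 0; first exact: spure0.
  by case: (nP al); apply/existsP; exists g.
pose deg (al : exponents D) := (\sum_i al i)%N.
case: (arg_minnP deg Pal0) => {Pal0} {}al0 /existsP [g0 /eqP fg0] min_al0.
pose top i := (qm D i).-1; pose be i := (top i - al0 i)%N.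
have le_top (al : exponents D) i : (al i <= top i)%N.
  by rewrite -ltnS prednK ?ltn_ord //; exact: leq_trans (qm_ge2 D i).
have [e e0 eE] := monomialM rel (fun i => al0 i) be.
have {}eE : monomial x (fun i => al0 i) * monomial x be = e *: monomial x top.
  by rewrite eE; congr (_ *: _); apply: eq_monomial => i; rewrite subnKC.
have kill al g : al != al0 -> spure M (f al g) (basis_elt iota x al g) *
    spure M 1 (monomial x be) = 0.
  move=> nal; have [->|nf] := eqVneq (f al g) 0; first by rewrite spure0 mul0r.
  have le_deg : (deg al0 <= deg al)%N by apply: min_al0; apply/existsP; exists g.
  (* If [al] were bounded by [al0] at every index, minimality of the degree of [al0] would force
     equality. *)
  have [i lt_i] : exists i, (al0 i < al i)%N.
    apply: contrapT => /forallNP nlt; case/eqP: nal; apply/ffunP => i.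
    have le j : (al j <= al0 j)%N by rewrite leqNgt; apply/negP/nlt.
    have := leqif_sum (P := predT) (fun j _ => leqif_eq (le j)).
    rewrite -/(deg al) -/(deg al0) => /(geq_leqif) /=.
    by rewrite le_deg => /esym/forallP/(_ i)/eqP/val_inj.
  rewrite spure_mulB // /basis_elt -mulrA (u_monomial rel) -scalerAr mulrA.
  have [c _ ->] := monomialM rel (fun i => al i) be.
  rewrite (monomial_vanish rel (i := i)) ?scaler0 ?mul0r ?scaler0 ?spure0r //.
  apply: (@leq_trans (top i).+1); first by rewrite /top leqSpred.
  by rewrite -{1}(subnK (le_top al0 i)) -addnS addnC leq_add2r.
(* Right multiplication by the idempotent of [psi^-1] replaces each [g] by [psi g], so the surviving
   terms add up to one Fourier coefficient of their coefficients; [psi] is chosen to make it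
   nonzero. *)
have [|psi Cpsi npsi] := @fourier_coef_neq0 k gT R
    (fun g => (e * monomial_char D be g) *: f al0 g) g0 k_char0 (qabelian D).
  move/eqP; rewrite scaler_eq0 mulf_eq0 (negPf e0) /= => /orP [|/eqP //].
  by rewrite (negPf (group_char_neq0 g0 (monomial_charP D be))).
(* The character of the idempotent after it has moved to the left of the top monomial, where the
   product becomes [t chi]. *)
pose chi g := (psi g)^-1 * (monomial_char D top g)^-1.
have Cpsi' := group_char_inv Cpsi.
have Cchi : group_char chi.
  exact/group_char_mul/group_char_inv/monomial_charP.
exists (monomial x be * char_idem iota (fun g => (psi g)^-1)).
exists (\sum_g psi g *: ((e * monomial_char D be g) *: f al0 g)), chi; split=> //.
have {}zE : z * spure M 1 (monomial x be) = \sum_g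
    spure M (f al0 g) (basis_elt iota x al0 g) * spure M 1 (monomial x be).
  rewrite zE mulr_suml (bigD1 al0) //= mulr_suml.
  rewrite [X in _ + X]big1 ?addr0 // => al nal.
  rewrite mulr_suml big1 // => g _; exact: kill.
rewrite -spure_mulB // mulrA zE mulr_suml.
have [S SE] := linear_funP (spure_linear_l M (t chi)).
rewrite -SE linear_sum; apply: eq_bigr => g _; rewrite !spure_mulB // SE.
have -> : basis_elt iota x al0 g * monomial x be =
    (e * monomial_char D be g) *: (monomial x top * iota g).
  rewrite /basis_elt -mulrA (u_monomial rel) -scalerAr mulrA eE -scalerAl.
  by rewrite scalerA mulrC.
rewrite -[_ *: _ * _]scalerAl -mulrA (u_char_idem rel _ Cpsi') invrK.
rewrite -[monomial x top * (_ *: _)]scalerAr (monomial_char_idem rel).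
by rewrite /spure !pureZr !pureZl !scalerA [psi g * _]mulrC.
Qed.

Lemma prime_of_t_act_neq0 : GRing.integral_domain_axiom R ->
  (forall chi, group_char chi -> exists r, M (t chi) r <> 0) ->
  prime_ring (smash M).
Proof.
move=> R_domain tneq0.
have C1 := group_char1 k gT.
have one_neq0 : 1 <> 0 :> R by apply/eqP; rewrite oner_eq0.
split=> [e|a b ab].
  apply: (spure_t_neq0 B_bos (M := M) k_char0 C1 one_neq0).
  by rewrite -[spure _ _ _]mul1r e mul0r.
apply: contrapT => /not_orP [na nb].
have [h [p [chi [Cchi np aE]]]] := smash_reduce na.
have [h' [v [chi' [Cchi' nv bE]]]] := smash_reduce nb.
(* This set of [w] is stable under the action of [B]: as [x_i t_chi' = 0], left multiplication of
   [w # t_chi'] by [1 # x_i] gives [x_i(w) # t_chi'], and [1 # g] acts similarly up to a nonzero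
   scalar. *)
pose Q w := forall c, a * c * spure M w (t chi') = 0.
have Qv : Q v by move=> c; rewrite -bE mulrA ab mul0r.
have Qx i w : Q w -> Q (M (x i) w).
  move=> Qw c; have := Qw (c * spure M 1 (x i)).
  by rewrite -!mulrA (spure_x B_bos) (y_t_elt rel) spure0r add0r.
have Qg g w : Q w -> Q (M (iota g) w).
  move=> Qw c; have := Qw (c * spure M 1 (iota g)).
  rewrite -!mulrA (spure_g B_bos) (u_t_elt rel) //.
  rewrite /spure pureZr -/(spure M _ _) !smash_mulZr => /eqP.
  by rewrite scaler_eq0 invr_eq0 (negPf (group_char_neq0 g Cchi')) => /eqP.
have QB c w w' : Q w -> Q w' -> Q (w - c *: w').
  move=> Qw Qw' d; rewrite addrC -scaleNr (spure_linear_l M (t chi') (- c) w' w).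
  by rewrite mulrDr smash_mulZr Qw Qw' scaler0 addr0.
have [w [Qw nw winv]] := exists_invariant B_bos Qx Qv nv.
have [|||c g u [Qu uinv]|la [s [Cla [Qs sinv] ns sE]]] :=
  @weight_vector k gT R (fun g => M (iota g)) _ _ _ (qabelian D)
    (fun w => Q w /\ invariant_under x M w) w _ (conj Qw winv) nw.
- by move=> g; exact: act_linear_r.
- by move=> r; rewrite (grouplike1 rel) Defs.act1.
- by move=> g g' r; rewrite (grouplikeM rel) Defs.actM.
- split=> [|i]; first exact/QB/Qu/Qg.
  by rewrite -scaleNr actD actZr uinv scaler0 addr0; exact: (act_xg0 B_bos).
(* The weight of [s # t_chi'] under left multiplication by the group. *)
pose mu g := la g * (chi' g)^-1.
have Cmu : group_char mu by apply/group_char_mul/group_char_inv.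
have [r nr] := tneq0 _ (group_char_mul Cchi Cmu).
(* With this middle factor the product is [(p # t_chi)(r s # t_chi')], that is
   [p t_(chi mu)(r) s # t_chi'], which is nonzero because [R] is a domain. *)
have := Qs (spure M 1 h * spure M r 1).
rewrite mulrA aE -mulrA spure_mulr spure_factor -mulrA.
rewrite (t_elt_smash B_bos chi (mu := mu)) => [|//|i|g].
- rewrite spure_mulr; apply: (spure_t_neq0 B_bos k_char0 Cchi').
  exact: (mul_neq0 R_domain np (mul_neq0 R_domain nr ns)).
- exact: (y_t_elt rel).
- by rewrite sE (u_t_elt rel) // /spure pureZl pureZr scalerA.
Qed.

End Prime.

Theorem corollary3 (k : closedFieldType) (k_char0 : [pchar k] =i pred0)
    (gT : finGroupType) (theta : nat) (D : qls_datum k gT theta)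
    (B : algType k) (Hs : hopf_algebra B)
    (iota : gT -> B) (x : 'I_theta -> B)
    (B_bos : qls_bosonization D Hs iota x)
    (R : algType k) (M : module_algebra Hs R)
    (R_domain : GRing.integral_domain_axiom R) :
  [<-> prime_ring (smash M);
       forall chi : gT -> k, group_char chi ->
         exists r : R, M (t_elt D iota x chi) r <> 0;
       exists s : {perm 'I_theta},
         (forall i : 'I_theta, exists r : R,
            killed_by M (x \o s) i r /\ M (x (s i)) r <> 0) /\
         (forall chi : gT -> k, group_char chi ->
            exists a : R, [/\ a <> 0, killed_by M (x \o s) theta a &
              forall g : gT, M (iota g) a = chi g^-1%g *: a])].
Proof.
tfae.
- exact: (t_act_neq0_of_prime B_bos k_char0).
- case/(killed_flag_of_t_act_neq0 B_bos) => flag weights.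
  exists 1%g; split=> [i|chi Cchi].
    have [r [rl nr]] := flag i; exists r; rewrite perm1.
    by split=> // j ji; rewrite /= perm1 rl.
  have [a [na ainv ga]] := weights chi Cchi.
  by exists a; split=> // i _ /=.
(* The cycle is closed by passing from (3) through (2) to (1). *)
case=> s [flag weights]; apply: (prime_of_t_act_neq0 B_bos k_char0 R_domain).
apply: (t_act_neq0_of_flag B_bos R_domain (s := s)) => // chi Cchi.
have [a [na ainv ga]] := weights chi Cchi.
(* Every index is below [theta] and is a value of [s], so [a] is killed by all the [x i]. *)
exists a; split=> // i; rewrite -(permKV s i).
exact: (ainv ((s^-1)%g i) (ltn_ord _)).
Qed.
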